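(* Let $d\in\mathbb N$, $\alpha\in(0,2)$, $m>0$, $\mu\in\mathbb R$. There is a constant $C=C(m,\alpha,d)>0$ such that the following holds. Let $w\in C^2(\mathbb R^d)\cap L^\infty(\mathbb R^d)$ be a $\mu$-antisymmetric function and suppose that there exists $x\in\mathcal U_\mu$ such that $w(x)=\inf_{y\in\mathcal U_\mu}w(y)<0$. Denote $\delta=\mu-x_1$. Then $$\Phi_{m,\alpha}(-\Delta)w(x)\le C\left((\delta^{-\alpha}-m)w(x)-\delta\int_{\mathcal U_\mu}\frac{(w(y)-w(x))(\mu-y_1)K_{(d+\alpha+2)/2}(m^{1/\alpha}|x-y^\mu|)}{|x-y^\mu|^{\frac{d+\alpha+2}{2}}}\,dy\right).$$ Moreover, if $\delta\in(0,\delta_1]$ with $0<\delta_1<\infty$, then there exists a constant $C=C(m,\alpha,d,\delta_1)>0$ such that $$\Phi_{m,\alpha}(-\Delta)w(x)\le C\left(\delta^{\frac{d-\alpha}{2}}w(x)-\delta\int_{\mathcal U_\mu}\frac{(w(y)-w(x))(\mu-y_1)K_{(d+\alpha+2)/2}(m^{1/\alpha}|x-y^\mu|)}{|x-y^\mu|^{\frac{d+\alpha+2}{2}}}\,dy\right).$$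
   Context: Write $x=(x_1,x')\in\mathbb R\times\mathbb R^{d-1}$. For $\mu\in\mathbb R$: $x^\mu=(2\mu-x_1,x')$, $\mathcal U_\mu=\{x\in\mathbb R^d:x_1<\mu\}$, and $w$ is $\mu$-antisymmetric if $w(x^\mu)=-w(x)$ for every $x\in\mathcal U_\mu$. $K_\xi(z)=\frac12(z/2)^\xi\int_0^\infty t^{-\xi-1}e^{-t-z^2/(4t)}dt$, $z>0$, is the modified Bessel function of the third kind. $\Phi_{m,\alpha}(z)=(z+m^{2/\alpha})^{\alpha/2}-m$, with jump kernel $$j_{m,\alpha}(r)=\frac{2^{\frac{\alpha-d}{2}}m^{\frac{d+\alpha}{2\alpha}}\alpha}{\pi^{d/2}\Gamma(1-\frac\alpha2)}r^{-\frac{d+\alpha}{2}}K_{\frac{d+\alpha}{2}}(m^{1/\alpha}r),\quad r>0.$$ For $w\in C^2(\mathbb R^d)\cap L^\infty(\mathbb R^d)$, pointwise, $$\Phi_{m,\alpha}(-\Delta)w(x)=-\frac12\int_{\mathbb R^d}(w(x+h)-2w(x)+w(x-h))j_{m,\alpha}(|h|)\,dh$$ (absolutely convergent), equivalently $\lim_{\varepsilon\to0}\int_{\mathbb R^d\setminus B_\varepsilon(x)}(w(x)-w(y))j_{m,\alpha}(|x-y|)\,dy$. A constant written $C(a,b,\dots)$ depends only on the listed parameters. *)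

(* Defs.v *)
From HB Require Import structures.
From mathcomp Require Import all_boot all_order all_algebra.
From mathcomp Require Import all_classical all_reals all_analysis.
Import Order.TTheory GRing.Theory Num.Theory.
Import numFieldNormedType.Exports.

Set Implicit Arguments.
Unset Strict Implicit.
Unset Printing Implicit Defensive.

Local Open Scope classical_set_scope.
Local Open Scope ring_scope.

(* R^n is 'rV[R]_n.  Its sigma-algebra is generated by the coordinate maps; by
   second countability it is the Borel sigma-algebra. *)
Definition rV_display : measure_display.
Proof. by []. Qed.

Section measurable_rV.
Context {R : realType} (n : nat).

Definition rV_coord (i : 'I_n) (x : 'rV[R]_n) : measurableTypeR R := x 0 i.

HB.instance Definition _ := @isMeasurable.Build rV_display 'rV[R]_n
  (g_sigma_preimage rV_coord) (@sigma_algebra0 _ _ _) (@sigma_algebraC _ _)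
  (@sigma_algebra_bigcup _ _ _).

End measurable_rV.

Lemma measurable_fun_rVP {R : realType} n d (T : measurableType d)
    (f : T -> 'rV[R]_n) :
  (forall i, measurable_fun setT (rV_coord i \o f)) -> measurable_fun setT f.
Proof.
move=> mf _ A mA; rewrite setTI.
suff: preimage_set_system setT f (g_sigma_preimage (@rV_coord R n)) `<=`
    measurable by apply; exists A => //; rewrite setTI.
rewrite -g_sigma_preimage_comp; apply: smallest_sub.
  exact: sigma_algebra_measurable.
case: n => [|n] in f mf {A mA} *; first by rewrite big_ord0.
rewrite -bigcup_mkord_ord; apply: bigcup_sub => i Ii B [C mC <-].
exact: mf.
Qed.

Lemma measurable_rV_coord {R : realType} n (i : 'I_n) :
  measurable_fun setT (@rV_coord R n i).
Proof.
move=> _ A mA; rewrite setTI; apply: sub_sigma_algebra => /=.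
by rewrite -bigcup_seq/=; exists i => /=; [rewrite mem_index_enum|
  exists A => //; rewrite setTI].
Qed.

(* Lebesgue measure on R^n: the Dirac mass of the only point for n = 0, and the
   image of (1-dimensional Lebesgue measure) \x (n-dimensional one) under
   (t, x') |-> (t, x') for n + 1. *)
Section rV_cons.
Context {R : realType} (n : nat).

Definition rV_cons (p : measurableTypeR R * 'rV[R]_n) : 'rV[R]_n.+1 :=
  \row_i oapp (fun j => p.2 0 j) p.1 (unlift ord0 i).

Lemma measurable_rV_cons : measurable_fun setT rV_cons.
Proof.
apply: measurable_fun_rVP => i.
case: (unliftP ord0 i) => [j ->|->].
  rewrite (_ : _ \o _ = rV_coord j \o snd); last first.
    by apply/funext => p; rewrite /rV_coord /= mxE liftK.
  by apply: measurableT_comp => //; exact: measurable_rV_coord.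
rewrite (_ : _ \o _ = fst) //.
by apply/funext => p; rewrite /rV_coord /= mxE unlift_none.
Qed.

Variable nu : {sigma_finite_measure set 'rV[R]_n -> \bar R}.

Definition rV_step : set 'rV[R]_n.+1 -> \bar R :=
  pushforward (@lebesgue_measure R \x nu)%E rV_cons.

Let rV_step0 : rV_step set0 = 0%E.
Proof. by rewrite /rV_step /pushforward preimage_set0 measure0. Qed.

Let rV_step_ge0 A : (0 <= rV_step A)%E.
Proof. by rewrite /rV_step /pushforward; exact: measure_ge0. Qed.

Let rV_step_sigma_additive : semi_sigma_additive rV_step.
Proof.
move=> F mF tF mUF; rewrite /rV_step /pushforward preimage_bigcup.
apply: measure_semi_sigma_additive.
- by move=> k; rewrite -[X in measurable X]setTI; exact: measurable_rV_cons.
- apply/trivIsetP => /= i j _ _ ij; rewrite -preimage_setI.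
  by move/trivIsetP : tF => /(_ _ _ _ _ ij) ->//; rewrite preimage_set0.
- rewrite -preimage_bigcup -[X in measurable X]setTI.
  exact: measurable_rV_cons.
Qed.

HB.instance Definition _ := isMeasure.Build _ _ _ rV_step
  rV_step0 rV_step_ge0 rV_step_sigma_additive.

Let rV_step_sigma_finite : sigma_finite setT rV_step.
Proof.
have /sigma_finiteP[F [FT ndF Foo]] := sigma_finiteT (@lebesgue_measure R).
have /sigma_finiteP[G [GT ndG Goo]] := sigma_finiteT nu.
pose split (x : 'rV[R]_n.+1) : measurableTypeR R * 'rV[R]_n :=
  (rV_coord ord0 x, \row_j x 0 (lift ord0 j)).
have splitK x : split (rV_cons x) = x.
  case: x => t x; congr pair; first by rewrite /rV_coord mxE unlift_none.
  by apply/rowP => j; rewrite !mxE liftK.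
have msplit : measurable_fun setT split.
  apply/measurable_fun_pairP; split; first exact: measurable_rV_coord.
  apply: measurable_fun_rVP => j.
  rewrite (_ : _ \o _ = rV_coord (lift ord0 j)); last first.
    by apply/funext => x; rewrite /rV_coord /= mxE.
  exact: measurable_rV_coord.
exists (fun k => split @^-1` (F k `*` G k)).
  rewrite -preimage_bigcup -[LHS](preimage_setT split); congr (_ @^-1` _).
  rewrite -setXTT FT GT predeqE => -[x y]; split.
    move=> [/= [i _ Fx] [j _ Gy]]; exists (maxn i j) => //; split.
    - by move: x Fx; exact/subsetPset/ndF/leq_maxl.
    - by move: y Gy; exact/subsetPset/ndG/leq_maxr.
  by move=> [i _ []/= ? ?]; split; exists i.
move=> k; have [mF Fk] := Foo k; have [mG Gk] := Goo k; split.
  by rewrite -[X in measurable X]setTI; apply: msplit => //; exact: measurableX.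
rewrite /rV_step /pushforward -comp_preimage.
rewrite (_ : split \o rV_cons = id); last exact/funext.
by rewrite preimage_id product_measure1E// lte_mul_pinfty// ge0_fin_numE.
Qed.

HB.instance Definition _ :=
  Measure_isSigmaFinite.Build _ _ _ rV_step rV_step_sigma_finite.

End rV_cons.

Fixpoint lebesgue_rV (R : realType) (n : nat) :
    {sigma_finite_measure set 'rV[R]_n -> \bar R} :=
  match n with
  | 0 => [the {sigma_finite_measure set _ -> \bar R} of dirac (0 : 'rV[R]_0)]
  | n'.+1 => [the {sigma_finite_measure set _ -> \bar R} of
               rV_step (lebesgue_rV R n')]
  end.

Arguments lebesgue_rV {R} n.

Lemma lebesgue_rV_box (R : realType) (n : nat) (A : 'I_n -> set R) :
  (forall i, measurable (A i : set (measurableTypeR R))) ->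
  lebesgue_rV n [set x : 'rV[R]_n | forall i, A i (x 0 i)] =
  (\prod_(i < n) lebesgue_measure (A i))%E.
Proof.
elim: n A => [|n IHn] A mA.
  rewrite big_ord0 /= diracE mem_set//; by case.
rewrite big_ord_recl -IHn// -product_measure1E//; last first.
  rewrite (_ : [set x | _] =
    \big[setI/setT]_(i < n) (rV_coord i @^-1` A (lift ord0 i))).
    apply: bigsetI_measurable => i _; rewrite -[X in measurable X]setTI.
    exact: measurable_rV_coord.
  apply/seteqP; split => x /=.
    by move=> Ax; rewrite -bigcap_seq => i _ /=; exact: Ax.
  by rewrite -bigcap_seq => Ax i; apply: Ax => /=; rewrite mem_index_enum.
rewrite /= /rV_step /pushforward; congr (product_measure1 _ _ _).
apply/seteqP; split => -[t x] /=.
  move=> Ax; split => [|i].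
    by have := Ax ord0; rewrite mxE unlift_none.
  by have := Ax (lift ord0 i); rewrite mxE liftK.
move=> [At Ax] i; rewrite mxE.
by case: (unliftP ord0 i) => [j ->|->].
Qed.

Section functions.
Context {R : realType}.

(* The norm of the normed module 'rV[R]_n is the maximum norm. *)
Definition enorm n (x : 'rV[R]_n) : R := Num.sqrt (\sum_i x 0 i ^+ 2).

Fixpoint Ck (k n : nat) (f : 'rV[R]_n -> R) : Prop :=
  match k with
  | 0 => continuous f
  | k'.+1 => continuous f /\
      forall i : 'I_n, (forall x, derivable f x (delta_mx 0 i)) /\
                       Ck k' (fun x => 'D_(delta_mx 0 i) f x)
  end.

(* Euler's Gamma function, for s > 0 *)
Definition Gamma (s : R) : R :=
  \int[lebesgue_measure]_(t in `]0, +oo[) (t `^ (s - 1) * expR (- t)).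

(* modified Bessel function of the third kind, for z > 0 *)
Definition besselK (xi z : R) : R :=
  2^-1 * (z / 2) `^ xi *
  \int[lebesgue_measure]_(t in `]0, +oo[)
     (t `^ (- xi - 1) * expR (- t - z ^+ 2 / (4 * t))).

(* j_{m,alpha}(r) on R^d *)
Definition jump_kernel (d : nat) (m alpha r : R) : R :=
  2 `^ ((alpha - d%:R) / 2) * m `^ ((d%:R + alpha) / (2 * alpha)) * alpha /
  (pi `^ (d%:R / 2) * Gamma (1 - alpha / 2)) *
  r `^ (- ((d%:R + alpha) / 2)) *
  besselK ((d%:R + alpha) / 2) (m `^ alpha^-1 * r).

(* Phi_{m,alpha}(-Delta) w (x); extended-real-valued so that no default value
   is substituted for a divergent integral. *)
Definition relativistic_op (d : nat) (m alpha : R) (w : 'rV[R]_d -> R)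
    (x : 'rV[R]_d) : \bar R :=
  (- (2^-1)%:E * \int[lebesgue_rV d]_h
     ((w (x + h) - 2 * w x + w (x - h)) * jump_kernel d m alpha (enorm h))%:E)%E.

(* Below, the dimension is n.+1 and the first coordinate is x 0 0. *)
Definition reflect_at n (mu : R) (x : 'rV[R]_n.+1) : 'rV[R]_n.+1 :=
  \row_i (if i == 0 then 2 * mu - x 0 0 else x 0 i).

Definition halfspace n (mu : R) : set 'rV[R]_n.+1 := [set x | x 0 0 < mu].

Definition antisymmetric_at n (mu : R) (w : 'rV[R]_n.+1 -> R) : Prop :=
  forall x, halfspace mu x -> w (reflect_at mu x) = - w x.

Definition reflected_integral n (m alpha mu : R) (w : 'rV[R]_n.+1 -> R)
    (x : 'rV[R]_n.+1) : \bar R :=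
  let nu := (n.+1%:R + alpha + 2) / 2 in
  (\int[lebesgue_rV n.+1]_(y in halfspace mu)
     ((w y - w x) * (mu - y 0 0) *
      besselK nu (m `^ alpha^-1 * enorm (x - reflect_at mu y)) /
      enorm (x - reflect_at mu y) `^ nu)%:E)%E.

End functions.

(* Main.v *)
From HB Require Import structures.
Require Import Defs.
From mathcomp Require Import all_boot all_order all_algebra.
From mathcomp Require Import all_classical all_reals all_analysis.
From mathcomp Require Import measurable_realfun ess_sup_inf ring lra.
Import Order.TTheory GRing.Theory Num.Theory.
Import numFieldNormedType.Exports.

Local Open Scope classical_set_scope.
Local Open Scope ring_scope.

(** Put v(y) = w(y) - w(x), delta = mu - x_1 and let y^mu be the reflection of
    y. Up to the factor -1/2 the operator integrates
    w(x + h) - 2 w(x) + w(x - h), that is v(x + h) + v(x - h), against the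
    radial kernel j. Where x + h stays in the half-space, v(x + h) is
    nonnegative because x is a minimum point. Where x + h = y^mu lies beyond
    the hyperplane, antisymmetry turns v(x + h) into - 2 w(x) - v(y). Collecting both sides on the half-space U,

      int v(x + h) j(h) dh = int_U v(y) (j(y - x) - j(y^mu - x)) dy
                             - 2 w(x) int_(h_1 > delta) j(h) dh.

    Two bounds on j finish the proof. First, as a function of s = |h|^2 the
    kernel is a multiple of G_nu(k s), where nu = (d + alpha) / 2,
    k = m^(2/alpha) and

      G_nu(s) = int_0^oo t^(-nu-1) e^(-t - s/(4t)) dt.

    Convexity of the exponential inside the integral gives
    G_nu(s) >= G_nu(s') + (s' - s)/4 G_(nu+1)(s') for s <= s'
    ([bessel_int_diff]), and since
    |y^mu - x|^2 - |y - x|^2 = 4 (mu - y_1) delta, the first integral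
    dominates a multiple of delta times the reflected integral of the
    statement, whose kernel is a multiple of G_(nu+1). Secondly, G_nu(s) >= c s^(-nu) for bounded s
    ([bessel_int_ge]), so that integrating over a cube of side delta placed
    beyond the hyperplane bounds the second integral below by c delta^(-alpha)
    ([integral_radial_kernel_beyond_ge]).

    All of this is carried out with nonnegative extended-real integrals, which
    only leaves one integral to be shown finite, that of v(y) j(y^mu - x) over
    U: w is essentially bounded, and j decays fast enough at distance at least
    delta ([integral_radial_kernel_beyond_fin]). The near-diagonal singularity
    of j occurs only where the second difference is nonnegative, so it can
    do no harm to the inequality, which is [integral_second_difference_ge].

    The two estimates of the theorem then follow from [relativistic_op_le] by
    choosing the constant. In the first, the coefficient of w(x) has the
    favourable sign once delta^(-alpha) <= m, hence only delta <= m^(-1/alpha)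
    matters; in the second delta^((d-alpha)/2) is delta^nu delta^(-alpha) and
    delta^nu is at most delta_1^nu. *)

(** * The integral in the Bessel function *)

Section half_line_integrals.
Context {R : realType}.
Local Notation leb := (@lebesgue_measure R).
Implicit Types (a s t nu S : R) (N : nat).

Lemma measurable_invr : measurable_fun setT (fun t : R => t^-1).
Proof.
rewrite (_ : (fun _ => _) = (fun t : R => t * (t ^+ 2) `^ (-1))).
  apply: measurable_funM => //.
  apply: (measurableT_comp (f := fun t : R => t `^ (-1))).
    exact: measurable_powR.
  exact: measurable_funX.
apply/funext => t; rewrite powR_inv1 ?sqr_ge0//.
have [->|t0] := eqVneq t 0; first by rewrite invr0 mul0r.
by rewrite expr2 invfM mulrA mulfV// mul1r.
Qed.

Lemma measurable_oneDsqrV (D : set R) :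
  measurable_fun D (fun t : R => ((1 + t ^+ 2)^-1)%:E).
Proof.
apply/measurable_EFinP/measurable_funTS.
apply: (measurableT_comp (f := fun t : R => t^-1)).
  exact: measurable_invr.
by apply: measurable_funD => //; exact: measurable_funX.
Qed.

Lemma integral_oneDsqrV_fin :
  (\int[leb]_(t in `]0%R, +oo[) ((1 + t ^+ 2)^-1)%:E < +oo)%E.
Proof.
rewrite integral_itv_obnd_cbnd; last first.
  exact: measurable_oneDsqrV.
have h : (\int[leb]_(t in `[0%R, +oo[) ((1 + t ^+ 2)^-1)%:E = (pi / 2)%:E)%E.
  exact: integral0y_oneDsqr.
move: h => /= ->; exact: ltry.
Qed.

Lemma expr_le_expR N (x : R) : 0 <= x -> x ^+ N <= N`!%:R * expR x.
Proof.
move=> x0; case: N => [|N]; first by rewrite expr0 fact0 mul1r -expR0 ler_expR.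
have := expR_ge1Dxn N x0; have : (0 : R) < N.+1`!%:R by rewrite ltr0n fact_gt0.
move=> f0 h; rewrite mulrC -ler_pdivrMr//; apply: le_trans h.
by rewrite lerDr.
Qed.

(** The factor (z/2)^xi of the Bessel function is left out, and s stands for
    z^2: in this form the function is decreasing and convex in s, with
    derivative -1/4 times the one of index nu + 1. *)
Definition bessel_integrand nu s t :=
  t `^ (- nu - 1) * expR (- t - s / (4 * t)).

Definition bessel_int nu s :=
  \int[leb]_(t in `]0, +oo[) bessel_integrand nu s t.

Lemma bessel_integrand_ge0 nu s t : 0 <= bessel_integrand nu s t.
Proof. by rewrite mulr_ge0 ?powR_ge0 ?expR_ge0. Qed.

Lemma measurable_bessel_integrand nu :
  measurable_fun setT (fun p : R * R => bessel_integrand nu p.1 p.2).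
Proof.
apply: measurable_funM.
  apply: (measurableT_comp (f := fun t : R => t `^ (- nu - 1))).
    exact: measurable_powR.
  exact: measurable_snd.
apply: (measurableT_comp (f := expR)); first exact: measurable_expR.
apply: measurable_funB.
  apply: measurable_funN.
  exact: measurable_snd.
apply: measurable_funM; first exact: measurable_fst.
apply: (measurableT_comp (f := fun t : R => t^-1)).
  exact: measurable_invr.
by apply: measurable_funM => //; exact: measurable_snd.
Qed.

Lemma measurable_bessel_integrandr nu s :
  measurable_fun setT (bessel_integrand nu s).
Proof.
exact: (measurableT_comp (measurable_bessel_integrand nu)
  (measurable_pair1 s)).
Qed.

(** Rapid decay in s and integrability in t at once: e^(-s/(4t)) is traded for
    (4t/s)^N, which also cancels the singularity of t^(-nu-1) at 0, and e^(-t)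
    for (1+t)^(-N-2), which leaves an integrable tail. *)
Lemma bessel_integrand_le nu s t N : -1 <= nu -> nu + 1 <= N%:R ->
  0 < s -> 0 < t ->
  bessel_integrand nu s t <=
  (N`!%:R * 4 ^+ N * expR 1 * (N.+2)`!%:R) / s ^+ N * (1 + t ^+ 2)^-1.
Proof.
move=> nu1 nuN s0 t0; rewrite /bessel_integrand.
rewrite (_ : - t - _ = - (s / (4 * t)) + - t); last by rewrite addrC.
rewrite expRD.
have y0 : 0 < s / (4 * t) by rewrite divr_gt0// mulr_gt0.
have h1 : expR (- (s / (4 * t))) <= N`!%:R * 4 ^+ N * t ^+ N / s ^+ N.
  have := expr_le_expR N _ (ltW y0).
  rewrite expRN -ler_pdivrMr ?expR_gt0// => h.
  have -> : N`!%:R * 4 ^+ N * t ^+ N / s ^+ N = N`!%:R / (s / (4 * t)) ^+ N.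
    rewrite exprMn exprVn exprMn; field.
    by rewrite !expf_neq0// gt_eqF.
  by rewrite ler_pdivlMr ?exprn_gt0// mulrC.
have h2 : expR (- t) <= expR 1 * (N.+2)`!%:R / (1 + t) ^+ N.+2.
  have t1 : 0 <= 1 + t by rewrite addr_ge0// ltW.
  have := expr_le_expR N.+2 _ t1; rewrite expRD mulrA (mulrC _ (expR 1)) => h.
  rewrite expRN ler_pdivlMr ?exprn_gt0// ?ltr_wpDr// ?(ltW t0)//.
  by rewrite mulrC ler_pdivrMr ?expR_gt0.
have h3 : t `^ (- nu - 1) * t ^+ N <= (1 + t) ^+ N.
  rewrite -(powR_mulrn N (ltW t0)) -powRD; last by rewrite (gt_eqF t0) implybT.
  apply: (@le_trans _ _ ((1 + t) `^ (- nu - 1 + N%:R))).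
    by apply: ge0_ler_powR; rewrite ?nnegrE; lra.
  by rewrite -powR_mulrn; [apply: ler_powR|]; lra.
have h4 : ((1 + t) ^+ 2)^-1 <= (1 + t ^+ 2)^-1.
  by rewrite lef_pV2 ?posrE; nra.
have t1 : 0 < 1 + t by lra.
have sN : 0 < s ^+ N by rewrite exprn_gt0.
apply: (@le_trans _ _ (t `^ (- nu - 1) * ((N`!%:R * 4 ^+ N * t ^+ N / s ^+ N) *
    (expR 1 * (N.+2)`!%:R / (1 + t) ^+ N.+2)))).
  rewrite ler_wpM2l ?powR_ge0//.
  by rewrite ler_pM ?expR_ge0.
set A := N`!%:R; set B := (N.+2)`!%:R; set E := expR 1; set F := 4 ^+ N.
have A0 : 0 <= A by rewrite ler0n.
have B0 : 0 <= B by rewrite ler0n.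
have E0 : 0 <= E by rewrite expR_ge0.
have F0 : 0 <= F by rewrite exprn_ge0.
have -> : t `^ (- nu - 1) *
    (A * F * t ^+ N / s ^+ N * (E * B / (1 + t) ^+ N.+2)) =
  (A * F * E * B / s ^+ N) *
  ((t `^ (- nu - 1) * t ^+ N) * ((1 + t) ^+ N.+2)^-1) by ring.
rewrite ler_wpM2l//.
  by rewrite mulr_ge0 ?invr_ge0 ?(ltW sN)// !mulr_ge0.
apply: le_trans h4.
rewrite -addn2 exprD invfM mulrA ler_piMl//.
  by rewrite invr_ge0 exprn_ge0// ltW.
by rewrite ler_pdivrMr ?exprn_gt0// mul1r.
Qed.

Definition bessel_bound N : R :=
  N`!%:R * 4 ^+ N * expR 1 * (N.+2)`!%:R *
  fine (\int[leb]_(t in `]0%R, +oo[) ((1 + t ^+ 2)^-1)%:E).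

Lemma bessel_bound_ge0 N : 0 <= bessel_bound N.
Proof.
apply: mulr_ge0; first by rewrite !mulr_ge0 ?ler0n ?exprn_ge0 ?expR_ge0.
apply: fine_ge0; apply: integral_ge0 => t _.
by rewrite lee_fin invr_ge0 addr_ge0// sqr_ge0.
Qed.

Lemma bessel_integral_le nu s N : -1 <= nu -> nu + 1 <= N%:R -> 0 < s ->
  (\int[leb]_(t in `]0%R, +oo[) (bessel_integrand nu s t)%:E <=
   (bessel_bound N / s ^+ N)%:E)%E.
Proof.
move=> nu1 nuN s0.
have mV := measurable_oneDsqrV.
pose c : R := N`!%:R * 4 ^+ N * expR 1 * (N.+2)`!%:R / s ^+ N.
have c0 : 0 <= c.
  rewrite !mulr_ge0 ?ler0n ?exprn_ge0 ?expR_ge0// invr_ge0 exprn_ge0//.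
  exact: ltW.
have mcV (D : set R) :
    measurable_fun D (fun t : R => (c%:E * ((1 + t ^+ 2)^-1)%:E)%E).
  by apply: emeasurable_funM => //; exact: mV.
have h : (\int[leb]_(t in `]0%R, +oo[) (bessel_integrand nu s t)%:E <=
    \int[leb]_(t in `]0%R, +oo[) (c%:E * ((1 + t ^+ 2)^-1)%:E))%E.
  apply: ge0_le_integral => //.
  - by move=> t _; rewrite lee_fin bessel_integrand_ge0.
  - apply/measurable_EFinP/measurable_funTS.
    exact: measurable_bessel_integrandr.
  - exact: mcV.
  - move=> t /=; rewrite in_itv/= andbT => t0.
    by rewrite -EFinM lee_fin bessel_integrand_le.
apply: le_trans h _.
rewrite ge0_integralZl//=; last first.
  by move=> t _; rewrite lee_fin invr_ge0 addr_ge0// sqr_ge0.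
  exact: mV.
rewrite -[X in (_ * X)%E]fineK; last first.
  rewrite ge0_fin_numE ?integral_oneDsqrV_fin//.
  by apply: integral_ge0 => t _; rewrite lee_fin invr_ge0 addr_ge0// sqr_ge0.
by rewrite -EFinM lee_fin /bessel_bound [leRHS]mulrAC.
Qed.

Lemma bessel_integrable nu s : -1 <= nu -> 0 < s ->
  leb.-integrable `]0, +oo[ (EFin \o bessel_integrand nu s).
Proof.
move=> nu1 s0; apply/integrableP; split.
  apply/measurable_EFinP/measurable_funTS; exact: measurable_bessel_integrandr.
under eq_integral do rewrite /= ger0_norm ?bessel_integrand_ge0//.
apply: (@le_lt_trans _ _
  ((bessel_bound (Num.truncn (nu + 1)).+1 / s ^+ (Num.truncn (nu + 1)).+1)%:E)).
  by apply: bessel_integral_le => //; rewrite ltW// truncnS_gt.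
exact: ltry.
Qed.

Lemma bessel_intE nu s : -1 <= nu -> 0 < s ->
  (\int[leb]_(t in `]0%R, +oo[) (bessel_integrand nu s t)%:E =
   (bessel_int nu s)%:E)%E.
Proof.
move=> nu1 s0; rewrite /bessel_int /Rintegral fineK//.
exact: integrable_fin_num (bessel_integrable nu s nu1 s0).
Qed.

Lemma bessel_int_ge0 nu s : 0 <= bessel_int nu s.
Proof. by apply: Rintegral_ge0 => t _; exact: bessel_integrand_ge0. Qed.

Lemma bessel_int_le nu s N : -1 <= nu -> nu + 1 <= N%:R -> 0 < s ->
  bessel_int nu s <= bessel_bound N / s ^+ N.
Proof.
by move=> nu1 nuN s0; rewrite -lee_fin -bessel_intE// bessel_integral_le.
Qed.

(** Seen as a partial integral of a nonnegative function of two variables, so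
    that Tonelli's theorem gives the measurability. *)
Lemma measurable_bessel_int nu : measurable_fun setT (bessel_int nu).
Proof.
have mD : measurable (setT `*` `]0, +oo[ : set (R * R)) by exact: measurableX.
pose f (p : R * R) : \bar R :=
  ((fun p => (bessel_integrand nu p.1 p.2)%:E) \_ (setT `*` `]0, +oo[)) p.
have mf : measurable_fun setT f.
  apply/(measurable_restrictT _ mD)/measurable_EFinP/measurable_funTS.
  exact: measurable_bessel_integrand.
have f0 p : (0 <= f p)%E.
  by apply: erestrict_ge0 => ? _; rewrite lee_fin bessel_integrand_ge0.
have := @measurable_fun_fubini_tonelli_F _ _ _ _ _ leb _ mf f0.
move=> /(measurableT_comp (@fine_measurable R setT measurableT)).
congr measurable_fun; apply/funext => s /=.
rewrite /bessel_int /Rintegral [in RHS]integral_mkcond; congr fine.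
apply: eq_integral => t _; rewrite /f !patchE.
by congr (if _ then _ else _); apply/idP/idP; rewrite !inE/=; tauto.
Qed.

(** Under the integral sign this is e^(-a) >= e^(-b) (1 + b - a) with
    a = s/(4t) and b = s'/(4t); the factor 1/t raises the index by one. *)
Lemma bessel_int_diff nu s s' : -1 <= nu -> 0 < s -> s <= s' ->
  bessel_int nu s' + (s' - s) / 4 * bessel_int (nu + 1) s' <= bessel_int nu s.
Proof.
move=> nu1 s0 ss'.
have s'0 : 0 < s' by exact: lt_le_trans ss'.
have nu2 : -1 <= nu + 1 by lra.
have c0 : 0 <= (s' - s) / 4 by lra.
rewrite -lee_fin EFinD EFinM -!bessel_intE//.
have pw t : 0 < t -> bessel_integrand nu s' t +
    (s' - s) / 4 * bessel_integrand (nu + 1) s' t <= bessel_integrand nu s t.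
  move=> t0; rewrite /bessel_integrand.
  rewrite (_ : - (nu + 1) - 1 = (- nu - 1) + (-1)); last by ring.
  rewrite [t `^ (- nu - 1 + -1)]powRD; last by rewrite (gt_eqF t0) implybT.
  rewrite powR_inv1 ?(ltW t0)//.
  set E := expR (- t - s' / (4 * t)).
  have -> : t `^ (- nu - 1) * E + (s' - s) / 4 * (t `^ (- nu - 1) * t^-1 * E) =
    t `^ (- nu - 1) * (E * (1 + (s' - s) / (4 * t))).
    by field; rewrite gt_eqF.
  rewrite ler_wpM2l ?powR_ge0//.
  have -> : - t - s / (4 * t) = - t - s' / (4 * t) + (s' - s) / (4 * t).
    by field; rewrite gt_eqF.
  by rewrite expRD ler_wpM2l ?expR_ge0// expR_ge1Dx.
have mb u v (D : set R) :
    measurable_fun D (fun t => (bessel_integrand u v t)%:E).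
  apply/measurable_EFinP/measurable_funTS; exact: measurable_bessel_integrandr.
have mb1 (D : set R) : measurable_fun D
    (fun t => ((s' - s) / 4)%:E * (bessel_integrand (nu + 1) s' t)%:E)%E.
  by apply: emeasurable_funM => //; exact: mb.
have mb2 (D : set R) : measurable_fun D
    (fun t => (bessel_integrand nu s' t)%:E +
      ((s' - s) / 4)%:E * (bessel_integrand (nu + 1) s' t)%:E)%E.
  by apply: emeasurable_funD; [exact: mb|exact: mb1].
have -> : ((\int[leb]_(t in `]0%R, +oo[) (bessel_integrand nu s' t)%:E +
    ((s' - s) / 4)%:E *
    \int[leb]_(t in `]0%R, +oo[) (bessel_integrand (nu + 1) s' t)%:E) =
  \int[leb]_(t in `]0%R, +oo[) ((bessel_integrand nu s' t)%:E +
    ((s' - s) / 4)%:E * (bessel_integrand (nu + 1) s' t)%:E))%E.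
  rewrite ge0_integralD//.
  - rewrite ge0_integralZl//; first exact: mb.
    by move=> t _; rewrite lee_fin bessel_integrand_ge0.
  - by move=> t _; rewrite lee_fin bessel_integrand_ge0.
  - exact: mb.
  - by move=> t _; rewrite mule_ge0// lee_fin bessel_integrand_ge0.
  - exact: mb1.
apply: ge0_le_integral => //.
- move=> t _; rewrite adde_ge0 ?lee_fin ?bessel_integrand_ge0//.
  by rewrite mulr_ge0 ?bessel_integrand_ge0.
- exact: mb2.
- exact: mb.
- by move=> t /=; rewrite in_itv/= andbT => t0; exact: pw.
Qed.

Lemma bessel_int_le_mono nu s s' : -1 <= nu -> 0 < s -> s <= s' ->
  bessel_int nu s' <= bessel_int nu s.
Proof.
move=> nu1 s0 ss'; apply: le_trans (bessel_int_diff nu s s' nu1 s0 ss').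
by rewrite lerDl mulr_ge0 ?bessel_int_ge0// divr_ge0// subr_ge0.
Qed.

(** The mass of the integral sits at t of order s: on ]s, 2s] the exponential
    is bounded below and t^(-nu-1) is at least (2s)^(-nu-1). *)
Lemma bessel_int_ge nu s S : 0 <= nu -> 0 < s <= S ->
  expR (- (2 * S + 4^-1)) * 2 `^ (- nu - 1) * s `^ (- nu) <= bessel_int nu s.
Proof.
move=> nu0 /andP[s0 sS].
have nu1 : -1 <= nu by lra.
set c := expR _.
rewrite -lee_fin -bessel_intE//.
apply: (@le_trans _ _ (\int[leb]_(t in `]s, (2 * s)%R])
   (bessel_integrand nu s t)%:E)%E); last first.
  apply: ge0_subset_integral => //.
  - apply/measurable_EFinP/measurable_funTS.
    exact: measurable_bessel_integrandr.
  - by move=> t _; rewrite lee_fin bessel_integrand_ge0.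
  - move=> t /=; rewrite !in_itv/= andbT => /andP[st _].
    exact: lt_trans st.
have -> : ((c * 2 `^ (- nu - 1) * s `^ (- nu))%:E =
    \int[leb]_(t in `]s, (2 * s)%R]) (c * (2 * s) `^ (- nu - 1))%:E)%E.
  rewrite integral_cst//= lebesgue_measure_itv/= lte_fin.
  rewrite ifT; last by lra.
  rewrite -EFinB -EFinM; congr EFin.
  rewrite powRM ?(ltW s0)//.
  rewrite (_ : 2 * s - s = s); last by ring.
  rewrite -!mulrA; congr (_ * (_ * _)).
  rewrite [LHS](_ : _ = s `^ (- nu - 1 + 1)); last by congr powR; ring.
  by rewrite powRD ?powRr1 ?(ltW s0)// (gt_eqF s0) implybT.
apply: ge0_le_integral => //.
- by move=> t _; rewrite lee_fin mulr_ge0 ?expR_ge0 ?powR_ge0.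
- apply/measurable_EFinP/measurable_funTS.
  exact: measurable_bessel_integrandr.
- move=> t /=; rewrite in_itv/= => /andP[st t2s].
  have t0 : 0 < t by exact: lt_trans st.
  rewrite lee_fin /bessel_integrand mulrC ler_pM ?expR_ge0 ?powR_ge0//.
    rewrite (_ : - nu - 1 = - (nu + 1)); last by ring.
    rewrite !powRN lef_pV2 ?posrE ?powR_gt0//; last by rewrite mulr_gt0.
    by apply: ge0_ler_powR; rewrite ?nnegrE; lra.
  rewrite ler_expR opprD lerB//; first by lra.
  rewrite ler_pdivrMr; last by lra.
  lra.
Qed.

(** The integrals over [1/(k+2), 1] are bounded by 1/(1-a), by the fundamental
    theorem of calculus, and increase to this one. *)
Lemma integral_powR_near0_fin a : 0 <= a < 1 ->
  (\int[leb]_(t in `]0%R, 1%R]) (t `^ (- a))%:E < +oo)%E.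
Proof.
move=> /andP[a0 a1].
pose F (k : nat) : set R := `[k.+2%:R^-1, 1]%classic.
have UF : `]0%R, 1%R]%classic = \bigcup_k F k.
  apply/seteqP; split => t /=.
    rewrite in_itv/= => /andP[t0 t1]; exists (Num.truncn t^-1) => //=.
    rewrite /F/= in_itv/= t1 andbT -[leRHS]invrK lef_pV2 ?posrE ?invr_gt0//.
    rewrite ltW// (lt_le_trans (truncnS_gt _))//.
    by rewrite ler_nat.
  move=> [k _]; rewrite /F/= !in_itv/= => /andP[kt ->]; rewrite andbT.
  by apply: lt_le_trans kt; rewrite invr_gt0.
rewrite UF.
have mp (D : set R) : measurable_fun D (fun t : R => (t `^ (- a))%:E).
  apply/measurable_EFinP/measurable_funTS; exact: measurable_powR.
have ndF : nondecreasing_seq F.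
  move=> k l kl; apply/subsetPset => t /=.
  rewrite /F/= !in_itv/= => /andP[kt ->]; rewrite andbT.
  by apply: le_trans kt; rewrite lef_pV2 ?posrE// ler_nat !ltnS.
have cvgF : (\int[leb]_(t in F k) (t `^ (- a))%:E @[k --> \oo] -->
    \int[leb]_(t in \bigcup_k F k) (t `^ (- a))%:E)%E.
  apply: ge0_nondecreasing_set_cvg_integral => //.
  - by move=> k; exact: measurable_itv.
  - by move=> k; exact: mp.
  - by move=> k t _; rewrite lee_fin powR_ge0.
apply: (@le_lt_trans _ _ ((1 - a)^-1)%:E); last exact: ltry.
rewrite -(cvg_lim _ cvgF)//; apply: lime_le.
  by apply/cvg_ex; eexists; exact: cvgF.
apply: nearW => k; rewrite /F.
have k1 : (k.+2%:R^-1 : R) < 1.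
  by rewrite invf_lt1 ?ltr0n// ltr1n.
have k0 : (0 : R) < k.+2%:R^-1 by rewrite invr_gt0.
have cpow b (t : R) : 0 < t -> {for t, continuous (fun t : R => t `^ b)}.
  move=> t0; apply: differentiable_continuous; apply/derivable1_diffP.
  by apply: derivable_powR; rewrite in_itv/= andbT.
rewrite (@continuous_FTC2 _ _ (fun t => t `^ (1 - a) / (1 - a)))//.
- rewrite powR1 mul1r -EFinB lee_fin lerBlDr lerDl.
  by rewrite divr_ge0 ?powR_ge0// subr_ge0 ltW.
- apply: continuous_in_subspaceT => t; rewrite inE/= in_itv/= => /andP[kt _].
  by apply: cpow; exact: lt_le_trans kt.
- split.
  + move=> t; rewrite in_itv/= => /andP[kt _].
    apply: derivableM => //; apply: derivable_powR.
    by rewrite in_itv/= andbT (lt_trans k0).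
  + apply: cvg_at_right_filter; apply: cvgM; last exact: cvg_cst.
    exact: cpow.
  + apply: cvg_at_left_filter; apply: cvgM; last exact: cvg_cst.
    exact: cpow.
- move=> t; rewrite in_itv/= => /andP[kt _].
  have t0 : 0 < t by exact: lt_trans kt.
  rewrite derive1E deriveM//; last first.
    by apply: derivable_powR; rewrite in_itv/= andbT.
  rewrite derive_cst scaler0 add0r -derive1E powR_derive1; last first.
    by rewrite in_itv/= andbT.
  rewrite /GRing.scale/= mulrA mulVf ?mul1r; last by rewrite subr_eq0 gt_eqF.
  by congr powR; ring.
Qed.

(** Finiteness is the point: the real-valued integral of a function with
    infinite integral would be 0. *)
Lemma Gamma_gt0 a : 0 <= a < 1 -> 0 < Gamma (1 - a).
Proof.
move=> /andP[a0 a1]; rewrite /Gamma /Rintegral.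
rewrite (_ : 1 - a - 1 = - a); last by ring.
have mg (D : set R) :
    measurable_fun D (fun t : R => (t `^ (- a) * expR (- t))%:E).
  apply/measurable_EFinP/measurable_funTS/measurable_funM.
    exact: measurable_powR.
  apply: (measurableT_comp (f := expR)); first exact: measurable_expR.
  exact: oppr_measurable.
have mp (D : set R) : measurable_fun D (fun t : R => (t `^ (- a))%:E).
  apply/measurable_EFinP/measurable_funTS; exact: measurable_powR.
have g0 t : (0 <= (t `^ (- a) * expR (- t))%:E)%E.
  by rewrite lee_fin mulr_ge0 ?powR_ge0 ?expR_ge0.
apply: fine_gt0; apply/andP; split.
  apply: (@lt_le_trans _ _ (\int[leb]_(t in `]0%R, 1%R]) (expR (-1))%:E)%E).
    rewrite integral_cst//= lebesgue_measure_itv/= lte_fin ltr01.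
    by rewrite -EFinB -EFinM lte_fin subr0 mulr1 expR_gt0.
  apply: (@le_trans _ _ (\int[leb]_(t in `]0%R, 1%R])
      (t `^ (- a) * expR (- t))%:E)%E).
    apply: ge0_le_integral => //; first exact: mg.
    move=> t /=; rewrite in_itv/= => /andP[t0 t1].
    rewrite lee_fin -[leLHS]mul1r ler_pM ?expR_ge0//; last first.
      by rewrite ler_expR lerN2.
    rewrite powRN invf_ge1 ?powR_gt0//.
    by rewrite -[leRHS](powRr0 t) ger_powR// t0.
  apply: ge0_subset_integral => //; first exact: mg.
  by move=> t /=; rewrite !in_itv/= => /andP[->].
have -> : (\int[leb]_(t in `]0%R, +oo[) (t `^ (- a) * expR (- t))%:E =
  \int[leb]_(t in `]0%R, 1%R]) (t `^ (- a) * expR (- t))%:E +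
  \int[leb]_(t in `]1%R, +oo[) (t `^ (- a) * expR (- t))%:E)%E.
  rewrite -ge0_integral_setU//=.
  - congr (integral _ _ _); rewrite -itv_bndbnd_setU//; rewrite ?bnd_simp//.
  - exact: mg.
  - apply/disj_setPLR => t /=; rewrite !in_itv/= andbT => /andP[_ t1].
    by apply/negP; rewrite -leNgt.
apply: lte_add_pinfty.
  apply: le_lt_trans (integral_powR_near0_fin a _); last by rewrite a0.
  apply: ge0_le_integral => //.
  - exact: mg.
  - exact: mp.
  - move=> t /=; rewrite in_itv/= => /andP[t0 _].
    rewrite lee_fin ler_piMr ?powR_ge0// -expR0 ler_expR.
    by rewrite oppr_le0 ltW.
have mV := measurable_oneDsqrV.
have V0 t : (0 <= ((1 + t ^+ 2)^-1)%:E :> \bar R)%E.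
  by rewrite lee_fin invr_ge0 addr_ge0// sqr_ge0.
have mfV (D : set R) :
    measurable_fun D (fun t : R => (4%:E * ((1 + t ^+ 2)^-1)%:E)%E).
  by apply: emeasurable_funM => //; exact: mV.
have pw (t : R) : 1 < t -> t `^ (- a) * expR (- t) <= 4 * (1 + t ^+ 2)^-1.
  move=> t1; have t0 : 0 < t by exact: lt_trans t1.
  have h1 : t `^ (- a) <= 1.
    rewrite powRN invf_le1 ?powR_gt0// -[leLHS](powRr0 t).
    by rewrite ler_powR// ltW.
  have := expr_le_expR 2 _ (ltW t0); rewrite (_ : 2`!%:R = 2)// => h2.
  apply: (@le_trans _ _ (expR (- t))).
    by rewrite ler_piMl ?expR_ge0.
  rewrite expRN ler_pdivlMr; last by nra.
  by rewrite mulrC ler_pdivrMr ?expR_gt0//; nra.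
have h1 : (\int[leb]_(t in `]1%R, +oo[) (t `^ (- a) * expR (- t))%:E <=
    \int[leb]_(t in `]1%R, +oo[) (4%:E * ((1 + t ^+ 2)^-1)%:E))%E.
  apply: ge0_le_integral => //; [exact: mg|exact: mfV|].
  by move=> t /=; rewrite in_itv/= andbT => t1; rewrite lee_fin pw.
have h2 : (\int[leb]_(t in `]1%R, +oo[) (4%:E * ((1 + t ^+ 2)^-1)%:E) <=
    \int[leb]_(t in `]0%R, +oo[) (4%:E * ((1 + t ^+ 2)^-1)%:E))%E.
  apply: ge0_subset_integral => //; first exact: mfV.
    by move=> t _; exact: mule_ge0.
  by move=> t /=; rewrite !in_itv/= !andbT; exact: lt_trans.
apply: le_lt_trans h1 _; apply: le_lt_trans h2 _.
rewrite ge0_integralZl//; last exact: mV.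
by rewrite lte_mul_pinfty// integral_oneDsqrV_fin.
Qed.

End half_line_integrals.

(** * Lebesgue measure on row vectors *)

Section lebesgue_rV_theory.
Context {R : realType}.
Local Notation leb := (@lebesgue_measure R).

Lemma ge0_integral_image d1 d2 (X : measurableType d1) (Y : measurableType d2)
    (mu : {measure set X -> \bar R}) (nu : {measure set Y -> \bar R})
    (phi : X -> Y) (D : set Y) (f : Y -> \bar R) :
  measurable_fun setT phi ->
  (forall A, measurable A -> mu (phi @^-1` A) = nu A) ->
  measurable D -> measurable_fun D f -> (forall y, D y -> 0 <= f y)%E ->
  (\int[nu]_(y in D) f y = \int[mu]_(x in phi @^-1` D) f (phi x))%E.
Proof.
move=> mphi munu mD mf f0.
rewrite -(ge0_integral_pushforward mphi mu mD mf); last first.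
  by move=> y; rewrite inE; exact: f0.
by apply: eq_measure_integral => A mA _; rewrite -munu.
Qed.

Lemma lebesgue_measure_sign_shift (s : bool) (c : R)
    (A : set (measurableTypeR R)) :
  measurable A -> leb ((fun t => (-1) ^+ s * t + c) @^-1` A) = leb A.
Proof.
move=> mA; pose f (t : measurableTypeR R) : measurableTypeR R :=
  (-1) ^+ s * t + c.
have mf : measurable_fun setT f.
  apply: continuous_measurable_fun => t.
  by apply: cvgD; [apply: cvgMl_tmp; exact: cvg_id|exact: cvg_cst].
pose F : {mfun _ >-> _} := HB.pack f (isMeasurableFun.Build _ _ _ _ f mf).
apply/esym; apply: (lebesgue_measure_unique (mu := pushforward leb F)) => //.
move=> _ [[a b] _ <-]; rewrite /pushforward /F/= /f.
rewrite lebesgue_measure_itv/=.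
case: s {f mf F} => /=; rewrite /pushforward.
  rewrite (_ : _ @^-1` _ = `[c - b, c - a[%classic); last first.
    apply/seteqP; split => t /=; rewrite !in_itv/= => /andP[h1 h2];
      apply/andP; split; move: h1 h2; rewrite expr1; lra.
  rewrite lebesgue_measure_itv/= !lte_fin ltrD2l ltrN2.
  by case: ifP => // _; rewrite -!EFinB; congr EFin; ring.
rewrite (_ : _ @^-1` _ = `]a - c, b - c]%classic); last first.
  apply/seteqP; split => t /=; rewrite !in_itv/= => /andP[h1 h2];
    apply/andP; split; move: h1 h2; rewrite expr0; lra.
rewrite lebesgue_measure_itv/= !lte_fin ltrD2r.
by case: ifP => // _; rewrite -!EFinB; congr EFin; ring.
Qed.

(** Translations, the central symmetry and the reflection in a hyperplane
    x_1 = mu are all of this coordinatewise form. *)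
Definition rV_sign_shift n (s : 'I_n -> bool) (c x : 'rV[R]_n) : 'rV[R]_n :=
  \row_i ((-1) ^+ s i * x 0 i + c 0 i).

Lemma measurable_sign_shift (s : bool) (c : R) :
  measurable_fun setT (fun t : R => (-1) ^+ s * t + c).
Proof. by apply: measurable_funD => //; exact: measurable_funM. Qed.

Lemma measurable_rV_sign_shift n (s : 'I_n -> bool) c :
  measurable_fun setT (rV_sign_shift n s c).
Proof.
apply: measurable_fun_rVP => i.
rewrite (_ : _ \o _ = (fun t : R => (-1) ^+ s i * t + c 0 i) \o rV_coord i).
  apply: measurableT_comp; first exact: measurable_sign_shift.
  exact: measurable_rV_coord.
by apply/funext => x; rewrite /rV_coord/= mxE.
Qed.

(** Through [rV_cons] the map becomes a product of a map of the line and a map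
    of the same form in one dimension less, so it suffices to compare the two
    measures on rectangles. *)
Lemma lebesgue_rV_sign_shift n (s : 'I_n -> bool) c (A : set 'rV[R]_n) :
  measurable A ->
  lebesgue_rV n (rV_sign_shift n s c @^-1` A) = lebesgue_rV n A.
Proof.
elim: n s c A => [|n IHn] s c A mA.
  congr (lebesgue_rV 0 _); apply/seteqP; split => x /=;
    by rewrite (thinmx0 (rV_sign_shift _ _ _ _)) (thinmx0 x).
pose s' i := s (lift ord0 i); pose c' := \row_i c 0 (lift ord0 i).
pose psi (p : measurableTypeR R * 'rV[R]_n) : measurableTypeR R * 'rV[R]_n :=
  ((-1) ^+ s ord0 * p.1 + c 0 ord0, rV_sign_shift n s' c' p.2).
have psiE p : rV_sign_shift n.+1 s c (rV_cons p) = rV_cons (psi p).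
  apply/rowP => i; rewrite !mxE.
  by case: (unliftP ord0 i) => [j ->|->]/=; rewrite ?mxE.
have mpsi : measurable_fun setT psi.
  apply/measurable_fun_pairP; split => /=.
    apply: (measurableT_comp (f := fun t : R => (-1) ^+ s ord0 * t + c 0 ord0)).
      exact: measurable_sign_shift.
    exact: measurable_fst.
  apply: (measurableT_comp (f := rV_sign_shift n s' c')).
    exact: measurable_rV_sign_shift.
  exact: measurable_snd.
pose F : {mfun _ >-> _} := HB.pack psi (isMeasurableFun.Build _ _ _ _ psi mpsi).
rewrite /= /rV_step /pushforward.
have -> : @rV_cons R n @^-1` (rV_sign_shift n.+1 s c @^-1` A) =
    psi @^-1` (@rV_cons R n @^-1` A).
  by apply/funext => p /=; rewrite /preimage/= psiE.
have mX : measurable (@rV_cons R n @^-1` A).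
  by rewrite -[X in measurable X]setTI; exact: measurable_rV_cons.
apply/esym; apply: (product_measure_unique
  (m' := pushforward (leb \x lebesgue_rV n)%E F)) => // B C mB mC.
transitivity ((leb \x lebesgue_rV n)%E
  (((fun t : measurableTypeR R => (-1) ^+ s ord0 * t + c 0 ord0) @^-1` B) `*`
   (rV_sign_shift n s' c' @^-1` C))); first by [].
rewrite product_measure1E.
- by rewrite IHn//; congr (_ * _)%E; exact: lebesgue_measure_sign_shift.
- by rewrite -[X in measurable X]setTI; exact: measurable_sign_shift.
- by rewrite -[X in measurable X]setTI; exact: measurable_rV_sign_shift.
Qed.

Lemma ge0_integral_rV_sign_shift n (s : 'I_n -> bool) c (D : set 'rV[R]_n)
    (f : 'rV[R]_n -> \bar R) :
  measurable D -> measurable_fun D f -> (forall x, D x -> 0 <= f x)%E ->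
  (\int[lebesgue_rV n]_(y in D) f y =
   \int[lebesgue_rV n]_(x in rV_sign_shift n s c @^-1` D)
     f (rV_sign_shift n s c x))%E.
Proof.
move=> mD mf f0; apply: ge0_integral_image => //.
  exact: measurable_rV_sign_shift.
exact: lebesgue_rV_sign_shift.
Qed.

Lemma integral_rV_prod_fin n (f : R -> R) : measurable_fun setT f ->
  (forall t, 0 <= f t) -> (\int[leb]_t (f t)%:E < +oo)%E ->
  (\int[lebesgue_rV n]_x (\prod_i f (x 0 i))%:E < +oo)%E.
Proof.
move=> mf f0 foo.
have mprod k : measurable_fun setT (fun x : 'rV[R]_k => (\prod_i f (x 0 i))%:E).
  apply/measurable_EFinP; apply: measurable_prod => i _.
  by apply: measurableT_comp; [exact: mf|exact: measurable_rV_coord].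
have prod0 k (x : 'rV[R]_k) : (0 <= (\prod_i f (x 0 i))%:E)%E.
  by rewrite lee_fin prodr_ge0.
elim: n => [|n IHn].
  rewrite /= (integral_dirac (0 : 'rV[R]_0) measurableT (mprod 0%N)).
  by rewrite diracT mul1e ltry.
have mcons := @measurable_rV_cons R n.
have -> : (\int[lebesgue_rV n.+1]_x (\prod_i f (x 0 i))%:E =
    \int[leb \x lebesgue_rV n]_p (\prod_i f (rV_cons p 0 i))%:E)%E.
  apply: (ge0_integral_image _ _ _ _ (leb \x lebesgue_rV n)%E
    (lebesgue_rV n.+1) (@rV_cons R n : measurableTypeR R * 'rV[R]_n -> _) setT
    (fun x => (\prod_i f (x 0 i))%:E)) => //.
  exact: mprod.
pose g (p : measurableTypeR R * 'rV[R]_n) : \bar R :=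
  ((f p.1)%:E * (\prod_i f (p.2 0 i))%:E)%E.
have gE p : ((\prod_i f (rV_cons p 0 i))%:E = g p)%E.
  rewrite big_ord_recl /g -EFinM mxE unlift_none/=; congr (_ * _)%:E.
  by apply: eq_bigr => i _; rewrite mxE liftK.
under eq_integral do rewrite gE.
have mg : measurable_fun setT g.
  apply: emeasurable_funM.
    apply/measurable_EFinP; apply: (measurableT_comp (f := f)) => //.
  apply: (measurableT_comp
    (f := fun x : 'rV[R]_n => (\prod_i f (x 0 i))%:E)) => //.
  exact: mprod.
rewrite fubini_tonelli1//; last by move=> p; rewrite /g mule_ge0// lee_fin.
set I := (\int[lebesgue_rV n]_x (\prod_i f (x 0 i))%:E)%E in IHn.
have I0 : (0 <= I)%E by exact: integral_ge0.
have -> : fubini_F (lebesgue_rV n) g = (fun t => (f t)%:E * I)%E.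
  apply/funext => t; rewrite /fubini_F /g/= ge0_integralZl//.
  - exact: mprod.
  - by move=> x _; exact: prod0.
  - by rewrite lee_fin.
rewrite ge0_integralZr//.
- by rewrite lte_mul_pinfty//; [apply: integral_ge0 => t _; rewrite lee_fin|
    rewrite ge0_fin_numE//; apply: integral_ge0 => t _; rewrite lee_fin].
- exact/measurable_EFinP.
- by move=> t _; rewrite lee_fin.
Qed.

Lemma integral_R_oneDsqrV_fin :
  (\int[leb]_t ((1 + t ^+ 2)^-1)%:E < +oo)%E.
Proof.
have sym := @ge0_symfun_integralT R (fun t => (1 + t ^+ 2)^-1).
have -> : (\int[leb]_t ((1 + t ^+ 2)^-1)%:E =
    2%:E * \int[leb]_(t in `[0%R, +oo[) ((1 + t ^+ 2)^-1)%:E)%E.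
  have -> : `[0%R, +oo[%classic = [set t : R | 0 <= t].
    by apply/seteqP; split => t /=; rewrite in_itv/= andbT.
  apply: sym.
  - by move=> t; rewrite invr_ge0 addr_ge0// sqr_ge0.
  - exact: continuous_oneDsqrV.
  - by move=> t/=; rewrite sqrrN.
have h : (\int[leb]_(t in `[0%R, +oo[) ((1 + t ^+ 2)^-1)%:E = (pi / 2)%:E)%E.
  exact: integral0y_oneDsqr.
by move: h => /= ->; rewrite -EFinM; exact: ltry.
Qed.

Definition sqnorm {n} (x : 'rV[R]_n) : R := \sum_i x 0 i ^+ 2.

Lemma sqnorm_ge0 n (x : 'rV[R]_n) : 0 <= sqnorm x.
Proof. by apply: sumr_ge0 => i _; exact: sqr_ge0. Qed.

Lemma measurable_sqnorm n : measurable_fun setT (@sqnorm n).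
Proof.
apply: measurable_sum => i; apply: measurable_funX.
exact: measurable_rV_coord.
Qed.

Lemma sqr_coord_le_sqnorm {n} (x : 'rV[R]_n) i : x 0 i ^+ 2 <= sqnorm x.
Proof.
rewrite /sqnorm (bigD1 i)//= lerDl; apply: sumr_ge0 => j _; exact: sqr_ge0.
Qed.

Lemma enormE n (x : 'rV[R]_n) : enorm x ^+ 2 = sqnorm x.
Proof. by rewrite sqr_sqrtr// sqnorm_ge0. Qed.

Lemma enorm_gt0 n (x : 'rV[R]_n) : (0 < enorm x) = (0 < sqnorm x).
Proof. by rewrite sqrtr_gt0. Qed.

Lemma measurable_rV_box n (A : 'I_n -> set R) :
  (forall i, measurable (A i : set (measurableTypeR R))) ->
  measurable [set x : 'rV[R]_n | forall i, A i (x 0 i)].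
Proof.
move=> mA; have -> : [set x : 'rV[R]_n | forall i, A i (x 0 i)] =
    \big[setI/setT]_(i < n) (rV_coord i @^-1` (A i)).
  apply/seteqP; split => x /=.
    by move=> Ax; rewrite -bigcap_seq => i _ /=; exact: Ax.
  by rewrite -bigcap_seq => Ax i; apply: Ax => /=; rewrite mem_index_enum.
apply: bigsetI_measurable => i _; rewrite -[X in measurable X]setTI.
exact: measurable_rV_coord.
Qed.

(** Makes the supremum norm a genuine essential supremum: its definition
    returns 0 on a null space. *)
Lemma lebesgue_rV_setT_gt0 n : (0 < lebesgue_rV n [set: 'rV[R]_n])%E.
Proof.
pose A (i : 'I_n) : set R := `[0, 1]%classic.
have mA i : measurable (A i : set (measurableTypeR R)) by exact: measurable_itv.
apply: (@lt_le_trans _ _ (lebesgue_rV n [set x | forall i, A i (x 0 i)])).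
  rewrite lebesgue_rV_box// big1 ?lte01// => i _.
  by rewrite lebesgue_measure_itv/= lte_fin ltr01 -EFinB subr0.
apply: le_measure => //; rewrite inE//; exact: measurable_rV_box.
Qed.

Lemma Lfun_infty_ae_bounded n (w : 'rV[R]_n -> R) :
  w \in Lfun (lebesgue_rV n) +oo%E ->
  exists M, \forall y \ae lebesgue_rV n, w y <= M.
Proof.
move=> /sub_Lfun_finLfun; rewrite inE /= /finite_norm unlock.
rewrite lebesgue_rV_setT_gt0; set f := abse \o _ => fin.
have [M eM] : exists M, (ess_sup (lebesgue_rV n) f <= M%:E)%E.
  by case: (ess_sup _ _) fin => // [r _|_]; [exists r|exists 0; rewrite leNye].
exists M; apply: filterS (ess_sup_ge (lebesgue_rV n) f) => y.
move=> /le_trans /(_ eM); rewrite /f/= lee_fin.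
by apply: le_trans; exact: ler_norm.
Qed.

(** The increments h for which x + h is beyond the hyperplane at distance delta
    from x. *)
Definition beyond n (delta : R) : set 'rV[R]_n.+1 := [set h | delta < h 0 0].

Lemma measurable_beyond n delta : measurable (beyond n delta).
Proof.
have -> : beyond n delta = setT `&` rV_coord ord0 @^-1` `]delta, +oo[%classic.
  rewrite setTI; apply/seteqP; split => h /=;
    by rewrite /rV_coord in_itv/= andbT.
by apply: measurable_rV_coord => //; exact: measurable_itv.
Qed.

Lemma measurable_halfspace n mu : measurable (@halfspace R n mu).
Proof.
have -> : @halfspace R n mu = setT `&` rV_coord ord0 @^-1` `]-oo, mu[%classic.
  by rewrite setTI; apply/seteqP; split => h /=; rewrite /rV_coord in_itv.
by apply: measurable_rV_coord => //; exact: measurable_itv.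
Qed.

End lebesgue_rV_theory.

(** * The kernel beyond a hyperplane *)

Section kernel_beyond_hyperplane.
Context {R : realType}.
Local Notation leb := (@lebesgue_measure R).
Variables (n : nat) (nu k : R).
Hypotheses (nu0 : 0 <= nu) (k0 : 0 < k).

Definition radial_kernel (h : 'rV[R]_n.+1) : R := bessel_int nu (k * sqnorm h).

Lemma radial_kernel_ge0 h : 0 <= radial_kernel h.
Proof. exact: bessel_int_ge0. Qed.

Lemma measurable_radial_kernel : measurable_fun setT radial_kernel.
Proof.
apply: (measurableT_comp (measurable_bessel_int nu)).
by apply: measurable_funM => //; exact: measurable_sqnorm.
Qed.

(** A lower bound by a product of one-variable functions, which makes negative
    powers of |h| integrable by iterated integration: on the set considered,
    |h|^2 is at least delta^2 and at least each h_i^2, hence also a multiple of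
    1 + h_i^2. The two spare powers of |h|^2 are estimated by delta^2. *)
Lemma sqnorm_beyond_ge (delta : R) (h : 'rV[R]_n.+1) : 0 < delta ->
  beyond n delta h ->
  (delta ^+ 2) ^+ 2 * (Num.min 1 (delta ^+ 2) / 2) ^+ n.+1 *
    \prod_i (1 + h 0 i ^+ 2) <= sqnorm h ^+ n.+3.
Proof.
move=> d0 hd.
have sd : delta ^+ 2 <= sqnorm h.
  apply: le_trans (sqr_coord_le_sqnorm h ord0).
  by rewrite ler_sqr ?nnegrE ?(ltW d0)// ltW// (lt_trans d0).
have e0 : 0 < Num.min 1 (delta ^+ 2) by rewrite lt_min ltr01 exprn_gt0.
set e := Num.min _ _ in e0 *.
have e1 : e <= 1 by rewrite ge_min lexx.
have ed : e <= delta ^+ 2 by rewrite ge_min lexx orbT.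
rewrite (exprD _ 2 n.+1) -mulrA; apply: ler_pM.
- exact: sqr_ge0.
- by rewrite mulr_ge0 ?exprn_ge0 ?divr_ge0 ?(ltW e0)// prodr_ge0// => i _;
    rewrite addr_ge0 ?sqr_ge0.
- by rewrite ler_sqr ?nnegrE ?sqr_ge0// sqnorm_ge0.
rewrite -[X in _ ^+ X * _]card_ord -prodr_const -big_split/=.
rewrite -[X in _ <= _ ^+ X]card_ord -prodr_const.
apply: ler_prod => i _; apply/andP; split.
  by rewrite mulr_ge0 ?divr_ge0 ?(ltW e0)// addr_ge0 ?sqr_ge0.
have := sqr_coord_le_sqnorm h i; have := sqr_ge0 (h 0 i).
nra.
Qed.

(** The bound on nu lets the kernel decay like |h|^(-2(d+2)), where d = n + 1,
    as [sqnorm_beyond_ge] requires. It holds for nu = (d + alpha) / 2 with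
    alpha < 2, also when d = 1. *)
Lemma integral_radial_kernel_beyond_fin (delta : R) : 0 < delta ->
  nu + 1 <= n.+3%:R ->
  (\int[lebesgue_rV n.+1]_(h in beyond n delta) (radial_kernel h)%:E < +oo)%E.
Proof.
move=> d0 nun.
pose c := (delta ^+ 2) ^+ 2 * (Num.min 1 (delta ^+ 2) / 2) ^+ n.+1.
have e0 : 0 < Num.min 1 (delta ^+ 2) by rewrite lt_min ltr01 exprn_gt0.
have c0 : 0 < c by rewrite mulr_gt0 ?exprn_gt0 ?divr_gt0.
pose C := bessel_bound n.+3 / k ^+ n.+3 / c.
have nu1 : -1 <= nu by apply: le_trans nu0; rewrite oppr_le0.
pose P (h : 'rV[R]_n.+1) := \prod_i (1 + h 0 i ^+ 2)^-1.
have P0 h : 0 <= P h.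
  by apply: prodr_ge0 => i _; rewrite invr_ge0 addr_ge0 ?sqr_ge0.
have bb0 : 0 <= bessel_bound n.+3 :> R by exact: bessel_bound_ge0.
have C0 : 0 <= C by rewrite !divr_ge0 ?exprn_ge0 ?(ltW k0) ?(ltW c0).
have mP (D : set 'rV[R]_n.+1) : measurable_fun D (fun h => (P h)%:E).
  apply/measurable_EFinP/measurable_funTS; apply: measurable_prod => i _.
  apply: (measurableT_comp (f := fun t : R => t^-1)).
    exact: measurable_invr.
  apply: measurable_funD => //; apply: measurable_funX.
  exact: measurable_rV_coord.
have pw h : beyond n delta h -> radial_kernel h <= C * P h.
  move=> hd; have := sqnorm_beyond_ge _ _ d0 hd; rewrite -/c => le_s.
  have P1 : 0 < \prod_i (1 + h 0 i ^+ 2).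
    by apply: prodr_gt0 => i _; rewrite ltr_wpDr ?sqr_ge0.
  have s0 : 0 < sqnorm h.
    apply: lt_le_trans (sqr_coord_le_sqnorm h ord0).
    by rewrite exprn_gt0// (lt_trans d0).
  apply: (le_trans (bessel_int_le nu _ n.+3 nu1 nun _)); first exact: mulr_gt0.
  rewrite exprMn invfM mulrA /C -[leRHS]mulrA; apply: ler_wpM2l.
    by rewrite divr_ge0// exprn_ge0// ltW.
  rewrite /P prodfV -invfM lef_pV2 ?posrE ?exprn_gt0//.
  exact: mulr_gt0.
have mk (D : set 'rV[R]_n.+1) :
    measurable_fun D (fun h => (radial_kernel h)%:E).
  apply/measurable_EFinP/measurable_funTS; exact: measurable_radial_kernel.
have mB := measurable_beyond n delta.
have h1 : (\int[lebesgue_rV n.+1]_(h in beyond n delta) (radial_kernel h)%:E <=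
    \int[lebesgue_rV n.+1]_(h in beyond n delta) (C%:E * (P h)%:E))%E.
  apply: ge0_le_integral => //.
  - by move=> h _; rewrite lee_fin radial_kernel_ge0.
  - by apply: emeasurable_funM.
apply: (le_lt_trans h1).
rewrite ge0_integralZl//; last by move=> h _; rewrite lee_fin.
rewrite lte_mul_pinfty//.
apply: (@le_lt_trans _ _ (\int[lebesgue_rV n.+1]_h (P h)%:E)%E).
  apply: ge0_subset_integral => //; first by move=> h _; rewrite lee_fin.
apply: (integral_rV_prod_fin n.+1 (fun t => (1 + t ^+ 2)^-1)).
- apply: (measurableT_comp (f := fun t : R => t^-1)).
    exact: measurable_invr.
  by apply: measurable_funD => //; exact: measurable_funX.
- by move=> t; rewrite invr_ge0 addr_ge0 ?sqr_ge0.
- exact: integral_R_oneDsqrV_fin.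
Qed.

(** With nu = (d + alpha) / 2 the exponent d - 2 nu is - alpha. The cube with
    sides ]delta, 2 delta[ lies beyond the hyperplane, has volume delta^d, and
    |h|^2 <= 4 d delta^2 on it. *)
Lemma integral_radial_kernel_beyond_ge (delta1 : R) : 0 < delta1 ->
  exists2 c : R, 0 < c & forall delta : R, 0 < delta <= delta1 ->
  ((c * delta `^ (n.+1%:R - 2 * nu))%:E <=
   \int[lebesgue_rV n.+1]_(h in beyond n delta) (radial_kernel h)%:E)%E.
Proof.
move=> d10.
pose q : R := n.+1%:R * 4 * k.
have q0 : 0 < q by rewrite !mulr_gt0.
pose S := q * delta1 ^+ 2.
pose c := expR (- (2 * S + 4^-1)) * 2 `^ (- nu - 1) * q `^ (- nu).
exists c; first by rewrite !mulr_gt0 ?expR_gt0 ?powR_gt0.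
move=> delta /andP[d0 dd1].
have nu1 : -1 <= nu by apply: le_trans nu0; rewrite oppr_le0.
pose A (i : 'I_n.+1) : set R := `]delta, 2 * delta[%classic.
pose box := [set x : 'rV[R]_n.+1 | forall i, A i (x 0 i)].
have mbox : measurable box.
  by apply: measurable_rV_box => i; exact: measurable_itv.
have mk (D : set 'rV[R]_n.+1) :
    measurable_fun D (fun h => (radial_kernel h)%:E).
  apply/measurable_EFinP/measurable_funTS; exact: measurable_radial_kernel.
apply: (@le_trans _ _
  (\int[lebesgue_rV n.+1]_(h in box) (radial_kernel h)%:E)%E); last first.
  apply: ge0_subset_integral => //.
  - exact: measurable_beyond.
  - by move=> h _; rewrite lee_fin radial_kernel_ge0.
  - by move=> h /(_ ord0); rewrite /A/= in_itv/= => /andP[].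
have volbox : lebesgue_rV n.+1 box = (delta ^+ n.+1)%:E.
  rewrite lebesgue_rV_box; last by move=> i; exact: measurable_itv.
  under eq_bigr do rewrite lebesgue_measure_itv/= lte_fin.
  rewrite ifT; last by lra.
  rewrite -EFinB (_ : 2 * delta - delta = delta); last by ring.
  by rewrite prodEFin prodr_const card_ord.
have -> : ((c * delta `^ (n.+1%:R - 2 * nu))%:E =
    \int[lebesgue_rV n.+1]_(h in box) (c * delta `^ (- (2 * nu)))%:E)%E.
  transitivity ((c * delta `^ (- (2 * nu)))%:E * (delta ^+ n.+1)%:E)%E;
    last by rewrite integral_cst//; congr (_ * _)%E; exact/esym/volbox.
  rewrite -EFinM; congr EFin.
  rewrite -[RHS]mulrA; congr (_ * _).
  rewrite -powR_mulrn ?(ltW d0)// -powRD ?(gt_eqF d0) ?implybT//.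
  by congr (_ `^ _); ring.
apply: ge0_le_integral => //.
  move=> h _; rewrite lee_fin mulr_ge0 ?powR_ge0//.
  by rewrite /c !mulr_ge0 ?expR_ge0 ?powR_ge0.
move=> h boxh; rewrite lee_fin.
have hi i : delta ^+ 2 <= h 0 i ^+ 2 <= 4 * delta ^+ 2.
  have := boxh i; rewrite /A/= in_itv/= => /andP[h1 h2].
  by apply/andP; split; nra.
have s0 : 0 < k * sqnorm h.
  rewrite mulr_gt0//; apply: lt_le_trans (sqr_coord_le_sqnorm h ord0).
  by apply: (lt_le_trans (exprn_gt0 2 d0)); have /andP[] := hi ord0.
have sle : k * sqnorm h <= q * delta ^+ 2.
  have : sqnorm h <= n.+1%:R * (4 * delta ^+ 2).
    have hsum : sqnorm h <= \sum_(i < n.+1) 4 * delta ^+ 2.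
      by apply: ler_sum => i _; have /andP[] := hi i.
    by apply: le_trans hsum _; rewrite sumr_const card_ord (mulr_natl (4 * _)).
  move=> /(ler_wpM2l (ltW k0)) /le_trans; apply.
  by rewrite le_eqVlt; apply/orP; left; apply/eqP; rewrite /q; ring.
have qd0 : 0 < q * delta ^+ 2 by rewrite mulr_gt0 ?exprn_gt0.
apply: (@le_trans _ _ (bessel_int nu (q * delta ^+ 2))); last first.
  exact: bessel_int_le_mono.
apply: le_trans (bessel_int_ge nu _ S nu0 _); last first.
  by rewrite qd0/= /S ler_wpM2l ?(ltW q0)// ler_sqr ?nnegrE// ?(ltW d10)// ltW.
rewrite powRM ?(ltW q0) ?sqr_ge0// -(powR_mulrn 2 (ltW d0)) -powRrM.
by rewrite mulrN mulrA.
Qed.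

End kernel_beyond_hyperplane.

(** * Antisymmetric functions at a minimum point *)

(** Monotonicity of the integral for f >= P - Q, where f may fail to be
    integrable: its negative part is below Q, so its integral is not minus
    infinity, and P + f^- <= f^+ + Q holds between nonnegative functions. *)
Lemma integral_ge_diff (R : realType) d (T : measurableType d)
    (mu : {measure set T -> \bar R}) (f P Q : T -> R) :
  measurable_fun setT f -> measurable_fun setT P -> measurable_fun setT Q ->
  (forall t, 0 <= P t) -> (forall t, 0 <= Q t) ->
  (forall t, P t - Q t <= f t) -> (\int[mu]_t (Q t)%:E < +oo)%E ->
  (\int[mu]_t (P t)%:E <= \int[mu]_t (f t)%:E + \int[mu]_t (Q t)%:E)%E.
Proof.
move=> mf mP mQ P0 Q0 PQf Qoo.
pose F t := (f t)%:E.
have mF : measurable_fun setT F by exact/measurable_EFinP.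
have mFp := measurable_funepos mF; have mFn := measurable_funeneg mF.
have mPe : measurable_fun setT (fun t => (P t)%:E) by exact/measurable_EFinP.
have mQe : measurable_fun setT (fun t => (Q t)%:E) by exact/measurable_EFinP.
have Fn_fin : (\int[mu]_t F^\- t)%E \is a fin_num.
  rewrite ge0_fin_numE; last by apply: integral_ge0 => t _; exact: funeneg_ge0.
  apply: le_lt_trans Qoo; apply: ge0_le_integral => //.
  move=> t _; rewrite funenegE -EFinN -EFin_max lee_fin ge_max Q0 andbT.
  by rewrite lerNl; apply: le_trans (PQf t); rewrite lerBrDr addNr.
rewrite [X in (_ <= X + _)%E]integralE addeAC leeBrDr//.
rewrite -!ge0_integralD//; try by move=> t _; rewrite lee_fin.
apply: ge0_le_integral => //.
- by move=> t _; rewrite adde_ge0// lee_fin.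
- exact: emeasurable_funD.
- exact: emeasurable_funD.
move=> t _; rewrite funeposE funenegE -EFinN -!EFin_max -!EFinD lee_fin.
have := PQf t; have [f0|f0] := leP 0 (f t).
  by rewrite max_r ?oppr_le0//; lra.
by rewrite max_l ?oppr_ge0 ?(ltW f0)//; lra.
Qed.


(** Among the five quantities only Q is known to be finite, so it is the one
    to be cancelled. *)
Lemma cancel_finite_part (R : realType) (r : R) (T Q I A D : \bar R) :
  0 <= r -> (0 <= T)%E -> (0 <= Q)%E -> (0 <= I)%E -> (Q < +oo)%E ->
  (Q + I <= A)%E -> (2%:E * (A + r%:E * T) <= D + 2%:E * Q)%E ->
  ((2 * r)%:E * T + 2%:E * I <= D)%E.
Proof.
move=> r0 T0 Q0 I0 Qoo AQI main.
have rT0 : (0 <= r%:E * T)%E by rewrite mule_ge0.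
have Qfin : (2%:E * Q)%E \is a fin_num by rewrite fin_numM// ge0_fin_numE.
rewrite -(leeD2rE _ _ Qfin); apply: le_trans main.
have A0 : (0 <= A)%E by apply: le_trans AQI; exact: adde_ge0.
have le2 : (2%:E * Q + 2%:E * I <= 2%:E * A)%E.
  by rewrite -ge0_muleDr// lee_pmul2l.
rewrite ge0_muleDr// EFinM -muleA -addeA addeC [(2%:E * I + _)%E]addeC.
exact: leeD.
Qed.

Section lebesgue_rV_changes_of_variables.
Context {R : realType}.
Variable n : nat.
Local Notation leb := (@lebesgue_rV R n.+1).
Implicit Types (h x y : 'rV[R]_n.+1) (mu : R).

Lemma sign_shift_translate x h :
  rV_sign_shift n.+1 (fun=> false) x h = x + h.
Proof. by apply/rowP => i; rewrite !mxE expr0 mul1r addrC. Qed.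

Lemma sign_shift_opp h :
  rV_sign_shift n.+1 (fun=> true) (0 : 'rV[R]_n.+1) h = - h.
Proof. by apply/rowP => i; rewrite !mxE expr1 mulN1r addr0. Qed.

Lemma sign_shift_reflect mu x y : rV_sign_shift n.+1 (fun i => i == ord0)
  (\row_i (if i == ord0 then 2 * mu - x 0 0 else - x 0 i)) y =
  reflect_at mu y - x.
Proof.
by apply/rowP => i; rewrite !mxE; case: eqP => [->|_];
  rewrite ?expr1 ?expr0; ring.
Qed.

Lemma measurable_translate x : measurable_fun setT (fun h => x + h).
Proof.
by rewrite -(funext (sign_shift_translate x)); exact: measurable_rV_sign_shift.
Qed.

Lemma measurable_rV_opp : measurable_fun setT (fun h : 'rV[R]_n.+1 => - h).
Proof.
by rewrite -(funext sign_shift_opp); exact: measurable_rV_sign_shift.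
Qed.

Lemma measurable_reflect_sub mu x :
  measurable_fun setT (fun y => reflect_at mu y - x).
Proof.
by rewrite -(funext (sign_shift_reflect mu x)); exact: measurable_rV_sign_shift.
Qed.

Lemma measurable_reflect_at mu :
  measurable_fun setT (@reflect_at R n mu).
Proof.
rewrite (_ : reflect_at mu = fun y => reflect_at mu y - 0).
  exact: measurable_reflect_sub.
by apply/funext => y; rewrite subr0.
Qed.

Lemma ge0_integral_opp (f : 'rV[R]_n.+1 -> \bar R) :
  measurable_fun setT f -> (forall h, 0 <= f h)%E ->
  (\int[leb]_h f h = \int[leb]_h f (- h)%R)%E.
Proof.
move=> mf f0; rewrite (ge0_integral_rV_sign_shift n.+1 (fun=> true) 0 setT f)//.
by rewrite preimage_setT; apply: eq_integral => h _; rewrite sign_shift_opp.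
Qed.

Lemma ge0_integral_translate x (D : set 'rV[R]_n.+1)
    (f : 'rV[R]_n.+1 -> \bar R) :
  measurable D -> measurable_fun D f -> (forall y, D y -> 0 <= f y)%E ->
  (\int[leb]_(y in D) f y =
   \int[leb]_(h in [set h | D (x + h)%R]) f (x + h)%R)%E.
Proof.
move=> mD mf f0.
rewrite (ge0_integral_rV_sign_shift n.+1 (fun=> false) x D f)//.
rewrite (_ : _ @^-1` D = [set h | D (x + h)]); last first.
  by apply/funext => h; rewrite /preimage/= sign_shift_translate.
by apply: eq_integral => h _; rewrite sign_shift_translate.
Qed.

Lemma ge0_integral_reflect mu x (D : set 'rV[R]_n.+1)
    (f : 'rV[R]_n.+1 -> \bar R) :
  measurable D -> measurable_fun D f -> (forall h, D h -> 0 <= f h)%E ->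
  (\int[leb]_(h in D) f h =
   \int[leb]_(y in [set y | D (reflect_at mu y - x)%R])
     f (reflect_at mu y - x)%R)%E.
Proof.
move=> mD mf f0.
rewrite (ge0_integral_rV_sign_shift n.+1 (fun i => i == ord0)
  (\row_i (if i == ord0 then 2 * mu - x 0 0 else - x 0 i)) D f)//.
rewrite (_ : _ @^-1` D = [set y | D (reflect_at mu y - x)]); last first.
  by apply/funext => h; rewrite /preimage/= sign_shift_reflect.
by apply: eq_integral => h _; rewrite sign_shift_reflect.
Qed.

Lemma reflect_atK mu y : reflect_at mu (reflect_at mu y) = y.
Proof. by apply/rowP => i; rewrite !mxE/=; case: eqP => [->|//]; ring. Qed.

Lemma sqnormN y : sqnorm (- y) = sqnorm y.
Proof. by apply: eq_bigr => i _; rewrite mxE sqrrN. Qed.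

Lemma sqnorm_reflect_sub mu x y : sqnorm (reflect_at mu y - x) =
  sqnorm (y - x) + 4 * (mu - y 0 0) * (mu - x 0 0).
Proof.
rewrite /sqnorm !big_ord_recl addrAC; congr (_ + _).
  by rewrite !mxE/=; ring.
by apply: eq_bigr => i _; rewrite !mxE.
Qed.

Lemma sqnorm_sub_gt0 x y : y != x -> 0 < sqnorm (y - x).
Proof.
move=> yx; rewrite lt_neqAle sqnorm_ge0 andbT eq_sym.
apply: contra_neq yx => s0; apply/eqP; rewrite -subr_eq0; apply/eqP/rowP => i.
rewrite [RHS]mxE; apply/eqP; rewrite -sqrf_eq0 eq_le sqr_ge0 andbT -[leRHS]s0.
exact: sqr_coord_le_sqnorm.
Qed.

End lebesgue_rV_changes_of_variables.

Section even_kernel.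
Context {R : realType}.
Variable n : nat.
Variable J : 'rV[R]_n.+1 -> R.
Hypotheses (J0 : forall h, 0 <= J h) (mJ : measurable_fun setT J).
Hypothesis (Jopp : forall h, J (- h) = J h).
Local Notation leb := (@lebesgue_rV R n.+1).

Lemma ge0_integral_symmetrize (f : 'rV[R]_n.+1 -> R) :
  measurable_fun setT f -> (forall h, 0 <= f h) ->
  (\int[leb]_h ((f h + f (- h)) * J h)%:E =
   2%:E * \int[leb]_h (f h * J h)%:E)%E.
Proof.
move=> mf f0.
have mfJ : measurable_fun setT (fun h => (f h * J h)%:E).
  by apply/measurable_EFinP; exact: measurable_funM.
have fJ0 h : (0 <= (f h * J h)%:E)%E by rewrite lee_fin mulr_ge0.
have mfN : measurable_fun setT
      (fun h : 'rV[R]_n.+1 => (f (- h) * J (- h))%:E).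
  exact: (measurableT_comp mfJ (measurable_rV_opp n)).
have eqN := ge0_integral_opp n _ mfJ fJ0.
transitivity (\int[leb]_h ((f h * J h)%:E + (f (- h) * J (- h))%:E))%E.
  by apply: eq_integral => h _; rewrite Jopp mulrDl.
rewrite ge0_integralD//.
by rewrite -eqN -[X in (X + X)%E]mul1e -ge0_muleDl// -EFinD.
Qed.

(** Turns a pointwise lower bound of a first difference g into an integral
    bound for the second difference g(h) + g(-h), with no principal value. *)
Lemma le_integral_second_difference (g a p q : 'rV[R]_n.+1 -> R) :
  measurable_fun setT g -> measurable_fun setT a -> measurable_fun setT p ->
  measurable_fun setT q -> (forall h, 0 <= a h) -> (forall h, 0 <= p h) ->
  (forall h, 0 <= q h) -> (forall h, a h + p h - q h <= g h) ->
  (\int[leb]_h (q h * J h)%:E < +oo)%E ->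
  (2%:E * (\int[leb]_h (a h * J h)%:E + \int[leb]_h (p h * J h)%:E) <=
   \int[leb]_h ((g h + g (- h)) * J h)%:E +
   2%:E * \int[leb]_h (q h * J h)%:E)%E.
Proof.
move=> mg ma mp mq a0 p0 q0 apq qoo.
have mN f : measurable_fun setT f ->
    measurable_fun setT (fun h : 'rV[R]_n.+1 => f (- h) : R).
  by move=> mf; exact: (measurableT_comp mf (measurable_rV_opp n)).
have map : measurable_fun setT (fun h => a h + p h) by exact: measurable_funD.
have ap0 h : 0 <= a h + p h by rewrite addr_ge0.
have <- : (\int[leb]_h ((a h + p h) * J h)%:E =
    \int[leb]_h (a h * J h)%:E + \int[leb]_h (p h * J h)%:E)%E.
  rewrite -ge0_integralD//.
  + by apply: eq_integral => h _; rewrite mulrDl EFinD.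
  + by move=> h _; rewrite lee_fin mulr_ge0.
  + by apply/measurable_EFinP; exact: measurable_funM.
  + by move=> h _; rewrite lee_fin mulr_ge0.
  + by apply/measurable_EFinP; exact: measurable_funM.
rewrite -(ge0_integral_symmetrize _ map ap0) -(ge0_integral_symmetrize _ mq q0).
apply: integral_ge_diff.
- by apply: measurable_funM => //; apply: measurable_funD => //; exact: mN.
- apply: measurable_funM => //; apply: measurable_funD => //.
  exact: (mN _ map).
- by apply: measurable_funM => //; apply: measurable_funD => //; exact: mN.
- by move=> h; rewrite mulr_ge0// addr_ge0.
- by move=> h; rewrite mulr_ge0// addr_ge0.
- move=> h; rewrite -mulrBl ler_wpM2r//.
  by have := apq h; have := apq (- h); lra.
- by rewrite (ge0_integral_symmetrize _ mq q0) lte_mul_pinfty.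
Qed.

Lemma integral_indicM (D : set 'rV[R]_n.+1) (f : 'rV[R]_n.+1 -> R) :
  (\int[leb]_h (f h * \1_D h * J h)%:E = \int[leb]_(h in D) (f h * J h)%:E)%E.
Proof.
rewrite [RHS]integral_mkcond; apply: eq_integral => h _.
rewrite patchE indicE; case: ifPn => _ /=; first by rewrite mulr1.
by rewrite mulr0 mul0r.
Qed.

End even_kernel.

(** J is any even kernel for which moving from y to its reflection costs at
    least K(y). *)
Section antisymmetric_minimum.
Context {R : realType}.
Variables (n : nat) (mu M : R) (w : 'rV[R]_n.+1 -> R) (x : 'rV[R]_n.+1).
Variables J K : 'rV[R]_n.+1 -> R.
Local Notation leb := (@lebesgue_rV R n.+1).
Local Notation U := (@halfspace R n mu).
Local Notation refl := (@reflect_at R n mu).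
Local Notation delta := (mu - x 0 0).
Implicit Types h y : 'rV[R]_n.+1.
Hypotheses (cw : continuous w) (mw : measurable_fun setT w).
Hypothesis bw : \forall y \ae leb, w y <= M.
Hypothesis aw : antisymmetric_at mu w.
Hypotheses (wx : forall y, halfspace mu y -> w x <= w y) (wx0 : w x <= 0).
Hypotheses (J0 : forall h, 0 <= J h) (mJ : measurable_fun setT J).
Hypothesis (Jopp : forall h, J (- h) = J h).
Hypothesis (Joo : (\int[leb]_(h in beyond n delta) (J h)%:E < +oo)%E).
Hypotheses (K0 : forall y, U y -> 0 <= K y) (mK : measurable_fun setT K).
Hypothesis (JK : forall y, U y -> y != x -> J (refl y - x) + K y <= J (y - x)).

(** Antisymmetry leaves the value of w on the hyperplane itself open; there the
    comparison with w(x) comes from continuity. *)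
Lemma min_closed_halfspace y : y 0 0 <= mu -> w x <= w y.
Proof.
move=> ymu.
pose f (t : R) : 'rV[R]_n.+1 := y - t *: delta_mx 0 0.
have f0 : f 0 = y by rewrite /f scale0r subr0.
have cf : f t @[t --> 0^'+] --> y.
  rewrite -[X in _ --> X]f0; apply: cvg_at_right_filter.
  apply: cvgB; first exact: cvg_cst.
  by apply: cvgZr_tmp; exact: cvg_id.
have cwf : w (f t) @[t --> 0^'+] --> w y.
  by apply: (cvg_comp _ _ cf); exact: cw.
apply: (cvgr_to_ge cwf); near=> t; apply: wx.
rewrite /halfspace/= /f !mxE/= mulr1.
have : 0 < t by near: t; exact: nbhs_right_gt.
lra.
Unshelve. all: by end_near. Qed.

Lemma reflect_beyond h : beyond n delta h -> U (refl (x + h)).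
Proof. by rewrite /beyond /halfspace/= !mxE/=; lra. Qed.

(* The decomposition of v(x + h): a is its value on the side of x; beyond the
   hyperplane it equals - 2 w(x) - v(y), with y the reflection of x + h, and p
   and q are the two terms. *)
Let a h : R := (w (x + h) - w x) * \1_(@halfspace R n delta) h.
Let p h : R := - 2 * w x * \1_(beyond n delta) h.
Let q h : R := (w (refl (x + h)) - w x) * \1_(beyond n delta) h.

Let a_ge0 h : 0 <= a h.
Proof.
rewrite /a indicE; case: (boolP (h \in _)) => hd /=; rewrite ?mulr0// mulr1.
move: hd; rewrite inE /halfspace/= => hd.
rewrite subr_ge0; apply: wx; rewrite /halfspace/= mxE; lra.
Qed.

Let p_ge0 h : 0 <= p h.
Proof.
rewrite /p indicE; case: (boolP (h \in _)) => hd /=; rewrite ?mulr0// mulr1.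
by rewrite mulNr -mulrN mulr_ge0// oppr_ge0.
Qed.

Let q_ge0 h : 0 <= q h.
Proof.
rewrite /q indicE; case: (boolP (h \in _)) => hd /=; rewrite ?mulr0// mulr1.
move: hd; rewrite inE => hd.
by rewrite subr_ge0; apply: wx; exact: reflect_beyond.
Qed.

Let apq_le h : a h + p h - q h <= w (x + h) - w x.
Proof.
rewrite /a /p /q !indicE.
have [hd|hd|hd] := ltgtP (h 0 0) delta.
- rewrite (mem_set (A := halfspace delta))// memNset; last first.
    by rewrite /beyond/= => /lt_trans /(_ hd); rewrite ltxx.
  by rewrite !mulr0 mulr1 addr0 subr0.
- rewrite (mem_set (A := beyond n delta))// memNset; last first.
    by rewrite /halfspace/= => /lt_trans /(_ hd); rewrite ltxx.
  have := aw _ (reflect_beyond h hd); rewrite reflect_atK => ->.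
  by rewrite !mulr0 !mulr1; lra.
- rewrite !memNset/halfspace/beyond/= ?hd ?ltxx//.
  rewrite !mulr0 addr0 subr0 subr_ge0; apply: min_closed_halfspace.
  by rewrite mxE hd; lra.
Qed.

Let mv : measurable_fun setT (fun y => w y - w x).
Proof. exact: measurable_funB. Qed.

Let mvx : measurable_fun setT (fun h => w (x + h) - w x).
Proof. exact: (measurableT_comp mv (measurable_translate n x)). Qed.

Let ma : measurable_fun setT a.
Proof.
apply: measurable_funM; first exact: mvx.
by apply: measurable_indic; exact: measurable_halfspace.
Qed.

Let mp : measurable_fun setT p.
Proof.
apply: measurable_funM => //.
by apply: measurable_indic; exact: measurable_beyond.
Qed.

Let mq : measurable_fun setT q.
Proof.
apply: measurable_funM; last first.
  by apply: measurable_indic; exact: measurable_beyond.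
apply: (measurableT_comp mv).
exact: (measurableT_comp (measurable_reflect_at n mu)
    (measurable_translate n x)).
Qed.

Let vJ_ge0 y z : U y -> (0 <= ((w y - w x) * J z)%:E)%E.
Proof. by move=> Uy; rewrite lee_fin mulr_ge0// subr_ge0; exact: wx. Qed.

Let mJsub : measurable_fun setT (fun y => J (y - x)).
Proof.
rewrite (_ : (fun _ => _) = (fun y => J (- x + y))); last first.
  by apply/funext => y; rewrite addrC.
exact: (measurableT_comp mJ (measurable_translate n (- x))).
Qed.

Let mJrefl : measurable_fun setT (fun y => J (refl y - x)).
Proof. exact: (measurableT_comp mJ (measurable_reflect_sub n mu x)). Qed.

Let mvJsub : measurable_fun U (fun y => ((w y - w x) * J (y - x))%:E).
Proof.
by apply/measurable_EFinP/measurable_funTS; exact: measurable_funM mv mJsub.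
Qed.

Let mvJrefl : measurable_fun U (fun y => ((w y - w x) * J (refl y - x))%:E).
Proof.
by apply/measurable_EFinP/measurable_funTS; exact: measurable_funM mv mJrefl.
Qed.

Let mvK : measurable_fun U (fun y => ((w y - w x) * K y)%:E).
Proof.
by apply/measurable_EFinP/measurable_funTS; exact: measurable_funM mv mK.
Qed.

Let beyond_reflect : [set y | beyond n delta (refl y - x)] = U.
Proof.
by apply/seteqP; split => y; rewrite /beyond /halfspace/= !mxE/=; lra.
Qed.

Lemma integral_same_side : (\int[leb]_h (a h * J h)%:E =
  \int[leb]_(y in U) ((w y - w x) * J (y - x))%:E)%E.
Proof.
rewrite (integral_indicM _ _ _ (fun h => w (x + h) - w x)).
rewrite [RHS](ge0_integral_translate n x U _ _ mvJsub); first last.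
- by move=> y Uy; exact: vJ_ge0.
- exact: measurable_halfspace.
have -> : [set h | U (x + h)] = @halfspace R n delta.
  by apply/seteqP; split => h; rewrite /halfspace/= mxE; lra.
by apply: eq_integral => h _; rewrite [x + h - x]addrAC subrr add0r.
Qed.

Lemma integral_other_side : (\int[leb]_h (q h * J h)%:E =
  \int[leb]_(y in U) ((w y - w x) * J (refl y - x))%:E)%E.
Proof.
rewrite (integral_indicM _ _ _ (fun h => w (refl (x + h)) - w x)).
rewrite (ge0_integral_reflect n mu x (beyond n delta)
  (fun h => ((w (refl (x + h)) - w x) * J h)%:E)).
- rewrite beyond_reflect; apply: eq_integral => y _.
  by rewrite [x + (refl y - x)]addrC subrK reflect_atK.
- exact: measurable_beyond.
- apply/measurable_EFinP/measurable_funTS; apply: measurable_funM mJ.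
  apply: (measurableT_comp mv).
  exact: (measurableT_comp (measurable_reflect_at n mu)
    (measurable_translate n x)).
- by move=> h hd; apply: vJ_ge0; exact: reflect_beyond.
Qed.

Lemma integral_other_side_fin :
  (\int[leb]_(y in U) ((w y - w x) * J (refl y - x))%:E < +oo)%E.
Proof.
have mJU : measurable_fun U (fun y => (J (refl y - x))%:E).
  by apply/measurable_EFinP/measurable_funTS; exact: mJrefl.
pose L := `|M| + - w x.
have L0 : 0 <= L by rewrite addr_ge0// oppr_ge0.
have le1 : (\int[leb]_(y in U) ((w y - w x) * J (refl y - x))%:E <=
    \int[leb]_(y in U) (L%:E * (J (refl y - x))%:E))%E.
  apply: ae_ge0_le_integral.
  - exact: measurable_halfspace.
  - by move=> y Uy; exact: vJ_ge0.
  - exact: mvJrefl.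
  - by move=> y Uy; apply: mule_ge0; rewrite lee_fin.
  - by apply: emeasurable_funM.
  - apply: filterS bw => y wyM Uy.
    rewrite -EFinM lee_fin ler_wpM2r// /L lerD2r.
    by apply: le_trans wyM _; exact: ler_norm.
apply: (le_lt_trans le1).
rewrite ge0_integralZl//; last 2 first.
- exact: measurable_halfspace.
- by move=> y _; rewrite lee_fin.
rewrite lte_mul_pinfty//.
rewrite [ltLHS](_ : _ = \int[leb]_(h in beyond n delta) (J h)%:E)%E//.
rewrite (ge0_integral_reflect n mu x (beyond n delta) (fun h => (J h)%:E)).
- by rewrite beyond_reflect.
- exact: measurable_beyond.
- by apply/measurable_EFinP/measurable_funTS.
- by move=> h _; rewrite lee_fin.
Qed.

Lemma integral_same_side_ge :
  (\int[leb]_(y in U) ((w y - w x) * J (refl y - x))%:E +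
   \int[leb]_(y in U) ((w y - w x) * K y)%:E <=
   \int[leb]_(y in U) ((w y - w x) * J (y - x))%:E)%E.
Proof.
have mU := measurable_halfspace n mu.
have vK0 y : U y -> (0 <= ((w y - w x) * K y)%:E)%E.
  by move=> Uy; rewrite lee_fin mulr_ge0 ?K0// subr_ge0 wx.
rewrite -ge0_integralD//; last by move=> y Uy; exact: vJ_ge0.
apply: ge0_le_integral => //.
- by move=> y Uy; apply: adde_ge0; [exact: vJ_ge0|exact: vK0].
- exact: emeasurable_funD.
move=> y Uy; rewrite -EFinD lee_fin -mulrDr.
have [->|yx] := eqVneq y x; first by rewrite (subrr (w x)) !mul0r.
by rewrite ler_wpM2l ?JK// subr_ge0 wx.
Qed.

(** The integral of q is finite, hence can be subtracted from both sides after
    being compared with the integral of a. *)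
Lemma integral_second_difference_ge :
  ((- 4 * w x)%:E * \int[leb]_(h in beyond n delta) (J h)%:E +
   2%:E * \int[leb]_(y in U) ((w y - w x) * K y)%:E <=
   \int[leb]_h ((w (x + h) - 2 * w x + w (x - h)) * J h)%:E)%E.
Proof.
have qoo : (\int[leb]_h (q h * J h)%:E < +oo)%E.
  by rewrite integral_other_side integral_other_side_fin.
have := le_integral_second_difference n J J0 mJ Jopp _ a p q
  mvx ma mp mq a_ge0 p_ge0 q_ge0 apq_le qoo.
rewrite integral_same_side integral_other_side.
have -> : (\int[leb]_h (p h * J h)%:E =
    (- 2 * w x)%:E * \int[leb]_(h in beyond n delta) (J h)%:E)%E.
  rewrite (integral_indicM _ _ _ (fun=> - 2 * w x)) -ge0_integralZl//.
  - exact: measurable_beyond.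
  - by apply/measurable_EFinP/measurable_funTS.
  - by move=> h _; rewrite lee_fin.
  - by rewrite lee_fin mulNr -mulrN mulr_ge0// oppr_ge0.
have -> : (\int[leb]_h ((w (x + h) - w x + (w (x - h) - w x)) * J h)%:E =
    \int[leb]_h ((w (x + h) - 2 * w x + w (x - h)) * J h)%:E)%E.
  by apply: eq_integral => h _; congr ((_ * _)%:E); ring.
rewrite (_ : - 4 * w x = 2 * (- 2 * w x)); last by ring.
apply: cancel_finite_part.
- by rewrite mulNr -mulrN mulr_ge0// oppr_ge0.
- by apply: integral_ge0 => h _; rewrite lee_fin.
- by apply: integral_ge0 => y Uy; exact: vJ_ge0.
- apply: integral_ge0 => y Uy.
  by rewrite lee_fin mulr_ge0 ?K0// subr_ge0; exact: wx.
- exact: integral_other_side_fin.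
- exact: integral_same_side_ge.
Qed.

End antisymmetric_minimum.

(** * The relativistic operator *)

Section bessel_form.
Context {R : realType}.
Implicit Types (xi kappa r m alpha : R).

Lemma besselK_div xi kappa r : 0 < kappa -> 0 < r ->
  besselK xi (kappa * r) / r `^ xi =
  2^-1 * (kappa / 2) `^ xi * bessel_int xi (kappa ^+ 2 * r ^+ 2).
Proof.
move=> k0 r0; rewrite /besselK -exprMn -/(bessel_int _ _).
rewrite (_ : kappa * r / 2 = kappa / 2 * r); last by rewrite mulrAC.
rewrite powRM ?divr_ge0 ?(ltW k0) ?(ltW r0)//.
have : r `^ xi != 0 by rewrite gt_eqF// powR_gt0.
by move: (bessel_int _ _) (r `^ xi) => B P P0; field.
Qed.

(** The factor of the jump kernel in front of [radial_kernel]. *)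
Definition jump_const (n : nat) m alpha : R :=
  2 `^ ((alpha - n.+1%:R) / 2) *
  m `^ ((n.+1%:R + alpha) / (2 * alpha)) * alpha /
  (pi `^ (n.+1%:R / 2) * Gamma (1 - alpha / 2)) *
  (2^-1 * (m `^ alpha^-1 / 2) `^ ((n.+1%:R + alpha) / 2)).

Lemma jump_const_gt0 n m alpha : 0 < alpha < 2 -> 0 < m ->
  0 < jump_const n m alpha.
Proof.
move=> /andP[a0 a2] m0.
have G0 : 0 < Gamma (1 - alpha / 2) by apply: Gamma_gt0; lra.
rewrite /jump_const !mulr_gt0 ?invr_gt0 ?mulr_gt0 ?powR_gt0 ?pi_gt0//.
by rewrite mulr_gt0 ?invr_gt0 ?powR_gt0.
Qed.

Lemma jump_kernelE n m alpha (h : 'rV[R]_n.+1) : 0 < m -> 0 < sqnorm h ->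
  jump_kernel n.+1 m alpha (enorm h) = jump_const n m alpha *
  radial_kernel n ((n.+1%:R + alpha) / 2) ((m `^ alpha^-1) ^+ 2) h.
Proof.
move=> m0 h0; have r0 : 0 < enorm h by rewrite enorm_gt0.
rewrite /jump_kernel /jump_const /radial_kernel -enormE.
rewrite -[RHS]mulrA -besselK_div ?powR_gt0//.
by rewrite powRN -mulrA [in RHS]mulrC -[RHS]mulrC; congr (_ * _); rewrite mulrC.
Qed.

End bessel_form.

Lemma half_opp_le (R : realType) (a q e : R) (T I D : \bar R) :
  0 <= a -> 0 <= q -> 0 < e -> (0 <= T)%E -> (0 <= I)%E ->
  ((2 * a)%:E * T + 2%:E * (q%:E * I) <= D)%E ->
  (- (2^-1)%:E * D <= - (a%:E * T + (q / e)%:E * (e%:E * I)))%E.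
Proof.
move=> a0 q0 e0 T0 I0 le_D; rewrite muleA -EFinM divfK ?gt_eqF//.
rewrite mulNe leeN2.
have -> : (a%:E * T + q%:E * I =
    (2^-1)%:E * ((2 * a)%:E * T + 2%:E * (q%:E * I)))%E.
  rewrite ge0_muleDr ?mule_ge0 ?lee_fin ?mulr_ge0//.
  by rewrite !muleA -!EFinM !mulrA mulVf// !mul1r.
by rewrite lee_pmul2l.
Qed.

(** T and I may be infinite; when I is, the left-hand side is -oo. *)
Lemma combine_constants (R : realType) (c q C d psi tau v : R) (T I : \bar R) :
  0 < q -> C * d <= q -> C * psi <= 2 * c * tau -> v < 0 -> 0 <= c -> 0 <= C ->
  0 <= d -> (tau%:E <= T)%E -> (0 <= I)%E ->
  (- ((2 * c * - v)%:E * T + q%:E * I) <=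
   C%:E * ((psi * v)%:E - d%:E * I))%E.
Proof.
move=> q0 Cd Cpsi v0 c0 C0 d0 tauT I0.
have cv0 : 0 <= 2 * c * - v by rewrite !mulr_ge0// oppr_ge0 ltW.
apply: (@le_trans _ _ (- ((2 * c * - v * tau)%:E + q%:E * I))%E).
  by rewrite leeN2 leeD2r// EFinM lee_wpmul2l.
case: I I0 => [r| |] //; last first.
  by move=> _; rewrite gt0_muley ?lte_fin// addey//= leNye.
rewrite lee_fin => r0.
suff : - (2 * c * - v * tau + q * r) <= C * (psi * v - d * r).
  by rewrite -lee_fin.
have := mulr_ge0 (_ : 0 <= q - C * d) r0; rewrite subr_ge0 => /(_ Cd) h1.
have : (2 * c * tau - C * psi) * v <= 0.
  by rewrite mulr_ge0_le0 ?subr_ge0// ltW.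
by move: h1; rewrite !mulrBl !mulrBr; lra.
Qed.

Section relativistic_minimum.
Context {R : realType}.
Variables (n : nat) (alpha m : R).
Hypotheses (halpha : 0 < alpha < 2) (hm : 0 < m).
Variables (mu : R) (w : 'rV[R]_n.+1 -> R) (x : 'rV[R]_n.+1).
Hypotheses (cw : continuous w) (wL : w \in Lfun (lebesgue_rV n.+1) +oo%E).
Hypotheses (aw : antisymmetric_at mu w) (Ux : halfspace mu x).
Hypothesis winf : w x = inf [set w y | y in halfspace mu].
Hypothesis wx0 : w x < 0.
Local Notation leb := (@lebesgue_rV R n.+1).
Local Notation U := (@halfspace R n mu).
Local Notation refl := (@reflect_at R n mu).
Local Notation delta := (mu - x 0 0).
Local Notation nu := ((n.+1%:R + alpha) / 2).
Local Notation kappa := (m `^ alpha^-1).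
Local Notation c := (jump_const n m alpha).
Local Notation e := (2^-1 * (kappa / 2) `^ (nu + 1)).
Implicit Types h y : 'rV[R]_n.+1.

(** The infimum of a set without lower bound is 0 by convention; w(x) < 0 rules
    this out. *)
Lemma min_on_halfspace y : U y -> w x <= w y.
Proof.
move=> Uy; rewrite winf; apply: ge_inf; last by exists y.
have : has_inf [set w y | y in U].
  apply: contrapT => /inf_out; rewrite -winf => w0.
  by move: wx0; rewrite w0 ltxx.
by move=> [].
Qed.

(** [integral_second_difference_ge] for the jump kernel, with the gain K given
    by [bessel_int_diff]: in K the index of the Bessel integral has gone up by
    one, which turns the integral of v K into the reflected integral. *)
Lemma relativistic_op_le :
  (relativistic_op m alpha w x <=
   - ((2 * c * - w x)%:E *
        \int[leb]_(h in beyond n delta) (radial_kernel n nu (kappa ^+ 2) h)%:E +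
      (c * kappa ^+ 2 * delta / e)%:E * reflected_integral m alpha mu w x))%E.
Proof.
have /andP[a0 a2] := halpha.
have k0 : 0 < kappa by rewrite powR_gt0.
have kk0 : 0 < kappa ^+ 2 by rewrite exprn_gt0.
have e0 : 0 < e by rewrite mulr_gt0 ?invr_gt0 ?powR_gt0 ?divr_gt0.
have c0 : 0 < c by exact: jump_const_gt0.
have d0 : 0 < delta by rewrite subr_gt0.
have n1 : (0 : R) <= n%:R by rewrite ler0n.
have nE : n.+1%:R = n%:R + 1 :> R by rewrite -natr1.
have nnE : n.+3%:R = n%:R + 3 :> R by rewrite -addn3 natrD.
have nu0 : 0 <= nu by rewrite nE; lra.
have nu1 : -1 <= nu by apply: le_trans nu0; rewrite oppr_le0.
have nun : nu + 1 <= n.+3%:R by rewrite nE nnE; lra.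
have [M bw] := Lfun_infty_ae_bounded n.+1 w wL.
have mw : measurable_fun setT w by have := sub_Lfun_mfun wL; rewrite inE.
pose G := radial_kernel n nu (kappa ^+ 2).
pose F y := (w y - w x) * (mu - y 0 0) *
  bessel_int (nu + 1) (kappa ^+ 2 * sqnorm (refl y - x)).
pose J h := c * G h.
pose K y := c * kappa ^+ 2 * delta *
  ((mu - y 0 0) * bessel_int (nu + 1) (kappa ^+ 2 * sqnorm (refl y - x))).
have mG : measurable_fun setT G by exact: measurable_radial_kernel.
have mJ : measurable_fun setT J by exact: measurable_funM.
have mB : measurable_fun setT (fun y =>
    (mu - y 0 0) * bessel_int (nu + 1) (kappa ^+ 2 * sqnorm (refl y - x))).
  apply: measurable_funM.
    by apply: measurable_funB => //; exact: measurable_rV_coord.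
  apply: (measurableT_comp (measurable_bessel_int (nu + 1))).
  apply: measurable_funM => //.
  exact: (measurableT_comp (measurable_sqnorm n.+1)
    (measurable_reflect_sub n mu x)).
have mK : measurable_fun setT K by exact: measurable_funM.
have mF : measurable_fun setT F.
  rewrite (_ : F = fun y => (w y - w x) * ((mu - y 0 0) *
    bessel_int (nu + 1) (kappa ^+ 2 * sqnorm (refl y - x)))).
    by apply: measurable_funM => //; exact: measurable_funB.
  by apply/funext => y; rewrite /F mulrA.
have mU := measurable_halfspace n mu.
have mB' := measurable_beyond n delta.
have G0 h : 0 <= G h by exact: radial_kernel_ge0.
have F0 y : U y -> (0 <= (F y)%:E)%E.
  move=> Uy; rewrite lee_fin !mulr_ge0 ?bessel_int_ge0 ?subr_ge0//.
    exact: min_on_halfspace.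
  exact: ltW.
have J0 h : 0 <= J h by rewrite mulr_ge0 ?(ltW c0).
have Jopp h : J (- h) = J h by rewrite /J /G /radial_kernel sqnormN.
have intJ : (\int[leb]_(h in beyond n delta) (J h)%:E =
    c%:E * \int[leb]_(h in beyond n delta) (G h)%:E)%E.
  rewrite -ge0_integralZl//.
  - by apply/measurable_EFinP/measurable_funTS.
  - by move=> h _; rewrite lee_fin.
  - by rewrite lee_fin ltW.
have Joo : (\int[leb]_(h in beyond n delta) (J h)%:E < +oo)%E.
  rewrite intJ lte_mul_pinfty ?lee_fin ?(ltW c0)//.
  exact: integral_radial_kernel_beyond_fin.
have K0 y : U y -> 0 <= K y.
  move=> Uy; apply: (mulr_ge0 (ltW (mulr_gt0 (mulr_gt0 c0 kk0) d0))).
  by apply: mulr_ge0; [rewrite subr_ge0 ltW|exact: bessel_int_ge0].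
(* |y^mu - x|^2 - |y - x|^2 = 4 (mu - y_1) delta, and the convexity estimate
   divides this by 4. *)
have JK y : U y -> y != x -> J (refl y - x) + K y <= J (y - x).
  move=> Uy yx; have s0 := sqnorm_sub_gt0 n x y yx.
  have ymu : 0 < mu - y 0 0 by rewrite subr_gt0.
  have refl_s := sqnorm_reflect_sub n mu x y.
  have le_s : kappa ^+ 2 * sqnorm (y - x) <= kappa ^+ 2 * sqnorm (refl y - x).
    rewrite ler_wpM2l ?(ltW kk0)// refl_s lerDl.
    by rewrite !mulr_ge0 ?ler0n ?(ltW d0) ?(ltW ymu).
  have := bessel_int_diff nu _ _ nu1 (mulr_gt0 kk0 s0) le_s.
  rewrite (_ : (_ - _) / 4 = kappa ^+ 2 * ((mu - y 0 0) * delta)); last first.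
    by rewrite refl_s; field.
  move=> /(ler_wpM2l (ltW c0)); apply: le_trans.
  by rewrite le_eqVlt; apply/orP; left; apply/eqP; rewrite /J /G /K
    /radial_kernel; ring.
have {J0 Jopp Joo K0 JK} := integral_second_difference_ge n mu M w x J K cw mw
  bw aw min_on_halfspace (ltW wx0) J0 mJ Jopp Joo K0 mK JK.
rewrite intJ.
have -> : (\int[leb]_(y in U) ((w y - w x) * K y)%:E =
    (c * kappa ^+ 2 * delta)%:E * \int[leb]_(y in U) (F y)%:E)%E.
  rewrite -ge0_integralZl//.
  - apply: eq_integral => y _; rewrite -EFinM; congr EFin.
    by rewrite /K /F; ring.
  - by apply/measurable_EFinP/measurable_funTS.
  - by rewrite lee_fin ltW// (mulr_gt0 (mulr_gt0 c0 kk0) d0).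
have -> : (relativistic_op m alpha w x = - (2^-1)%:E *
    \int[leb]_h ((w (x + h) - 2 * w x + w (x - h)) * J h)%:E)%E.
  rewrite /relativistic_op; congr (_ * _)%E; apply: eq_integral => h _.
  (* At h = 0 the second difference vanishes, whatever the kernel. *)
  congr EFin; have [->|h0] := eqVneq h 0.
    by rewrite addr0 subr0 (_ : w x - 2 * w x + w x = 0) ?mul0r//; ring.
  rewrite jump_kernelE//.
  by rewrite -[h]subr0; exact: sqnorm_sub_gt0.
have -> : (reflected_integral m alpha mu w x =
    e%:E * \int[leb]_(y in U) (F y)%:E)%E.
  rewrite /reflected_integral -ge0_integralZl//.
  - apply: eq_integral => y; rewrite inE => Uy.
    rewrite -EFinM; congr EFin.
    have z0 : 0 < enorm (x - refl y).
      rewrite enorm_gt0 -sqnormN opprB; apply: sqnorm_sub_gt0.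
      apply/eqP => /(congr1 (fun z : 'rV[R]_n.+1 => z 0 0)).
      by rewrite !mxE/= => h; move: Uy Ux; rewrite /halfspace/=; lra.
    have -> : (n.+1%:R + alpha + 2) / 2 = nu + 1 by lra.
    rewrite -[LHS]mulrA (besselK_div _ _ _ k0 z0) enormE.
    by rewrite -(sqnormN n (x - refl y)) opprB [LHS]mulrCA.
  - by apply/measurable_EFinP/measurable_funTS.
  - by rewrite lee_fin ltW.
move=> core; apply: half_opp_le => //.
- by apply: (mulr_ge0 (ltW (mulr_gt0 _ c0))) => //; rewrite oppr_ge0 ltW.
- exact: ltW (mulr_gt0 (mulr_gt0 c0 kk0) d0).
- by apply: integral_ge0 => h _; rewrite lee_fin.
- by apply: integral_ge0 => y; exact: F0.
- move: core; rewrite muleA -EFinM; congr (_ * _ + _ <= _)%E.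
  by congr EFin; ring.
Qed.

(** Here psi is the coefficient wanted in front of w(x) and tau a lower bound of
    the tail of the kernel. As w(x) < 0, a smaller C weakens both terms when
    psi >= 0, while psi <= 0 requires only tau = 0. *)
Lemma relativistic_op_le_of_tail (C psi tau : R) : 0 < C ->
  C * e <= c * kappa ^+ 2 -> C * psi <= 2 * c * tau -> 0 <= tau ->
  (tau%:E <= \int[leb]_(h in beyond n delta)
     (radial_kernel n nu (kappa ^+ 2) h)%:E)%E ->
  (relativistic_op m alpha w x <=
   C%:E * ((psi * w x)%:E - delta%:E * reflected_integral m alpha mu w x))%E.
Proof.
move=> C0 Ce Cpsi tau0 tauT; apply: (le_trans relativistic_op_le).
have e0 : 0 < e by rewrite mulr_gt0 ?invr_gt0 ?powR_gt0 ?divr_gt0 ?powR_gt0.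
have d0 : 0 < delta by rewrite subr_gt0.
have c0 : 0 < c by exact: jump_const_gt0.
have kk0 : 0 < kappa ^+ 2 by rewrite exprn_gt0// powR_gt0.
apply: combine_constants tauT _ => //.
- by apply: (divr_gt0 _ e0); exact: (mulr_gt0 (mulr_gt0 c0 kk0) d0).
- by rewrite mulrAC ler_pM2r// ler_pdivlMr.
- exact: ltW.
- exact: ltW.
- exact: ltW.
- apply: integral_ge0 => y Uy; rewrite lee_fin !mulr_ge0 ?invr_ge0 ?powR_ge0//.
  + by rewrite subr_ge0 min_on_halfspace.
  + by rewrite subr_ge0 ltW.
  + by apply: Rintegral_ge0 => t _; rewrite mulr_ge0 ?powR_ge0 ?expR_ge0.
Qed.

End relativistic_minimum.

(* The dimension of the space is d = n.+1. *)
Theorem lemma4p3 (R : realType) (n : nat) (alpha m : R)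
    (halpha : 0 < alpha < 2) (hm : 0 < m) :
  (exists C : R, 0 < C /\
    forall (mu : R) (w : 'rV[R]_n.+1 -> R) (x : 'rV[R]_n.+1),
      Ck 2%N w -> w \in Lfun (lebesgue_rV n.+1) +oo%E ->
      antisymmetric_at mu w ->
      halfspace mu x -> w x = inf [set w y | y in halfspace mu] -> w x < 0 ->
      let delta := mu - x 0 0 in
      (relativistic_op m alpha w x <=
       C%:E * (((delta `^ (- alpha) - m) * w x)%:E
               - delta%:E * reflected_integral m alpha mu w x))%E)
  /\
  (forall delta1 : R, 0 < delta1 ->
   exists C : R, 0 < C /\
    forall (mu : R) (w : 'rV[R]_n.+1 -> R) (x : 'rV[R]_n.+1),
      Ck 2%N w -> w \in Lfun (lebesgue_rV n.+1) +oo%E ->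
      antisymmetric_at mu w ->
      halfspace mu x -> w x = inf [set w y | y in halfspace mu] -> w x < 0 ->
      let delta := mu - x 0 0 in
      0 < delta <= delta1 ->
      (relativistic_op m alpha w x <=
       C%:E * ((delta `^ ((n.+1%:R - alpha) / 2) * w x)%:E
               - delta%:E * reflected_integral m alpha mu w x))%E).
Proof.
have /andP[a0 a2] := halpha.
pose nu : R := (n.+1%:R + alpha) / 2.
pose kappa : R := m `^ alpha^-1.
pose c := jump_const n m alpha.
pose e : R := 2^-1 * (kappa / 2) `^ (nu + 1).
have k0 : 0 < kappa by rewrite powR_gt0.
have kk0 : 0 < kappa ^+ 2 by rewrite exprn_gt0.
have e0 : 0 < e by rewrite mulr_gt0 ?invr_gt0 ?powR_gt0 ?divr_gt0.
have c0 : 0 < c by exact: jump_const_gt0.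
have nu0 : 0 <= nu by rewrite divr_ge0// addr_ge0 ?ler0n// ltW.
have tail delta1 : 0 < delta1 -> exists2 t : R, 0 < t &
    forall delta : R, 0 < delta <= delta1 ->
    ((t * delta `^ (- alpha))%:E <= \int[lebesgue_rV n.+1]_(h in beyond n delta)
      (radial_kernel n nu (kappa ^+ 2) h)%:E)%E.
  move=> d10.
  have [t t0 ht] := integral_radial_kernel_beyond_ge n nu _ nu0 kk0 delta1 d10.
  exists t => // delta /ht; congr (_%:E <= _)%E; congr (_ * _ `^ _).
  by rewrite /nu; field.
pose q := c * kappa ^+ 2 / e.
have q0 : 0 < q by rewrite divr_gt0// mulr_gt0.
split.
  (* Beyond this distance delta^(-alpha) - m <= 0, so that tau = 0 will do. *)
  pose delta1 : R := m `^ (- alpha^-1).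
  have d10 : 0 < delta1 by rewrite powR_gt0.
  have [t t0 ht] := tail _ d10.
  pose C := Num.min q (2 * c * t).
  have C0 : 0 < C by rewrite lt_min q0/= mulr_gt0// mulr_gt0.
  have Cq : C <= q by rewrite ge_min lexx.
  have Ct : C <= 2 * c * t by rewrite ge_min lexx orbT.
  exists C; split => // mu w x [cw _] wL aw Ux winf wx0.
  set delta := mu - x 0 0; cbv zeta.
  have d0 : 0 < delta by rewrite subr_gt0.
  have Ce : C * e <= c * kappa ^+ 2 by rewrite -ler_pdivlMr.
  have [dd1|dd1] := leP delta delta1.
    apply: (relativistic_op_le_of_tail n alpha m halpha hm mu w x cw wL aw Ux
      winf wx0 C _ (t * delta `^ (- alpha))) => //.
    - rewrite mulrA; apply: (@le_trans _ _ (C * delta `^ (- alpha))).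
        by rewrite ler_wpM2l ?(ltW C0)// gerBl ltW.
      by rewrite ler_wpM2r ?powR_ge0.
    - by rewrite mulr_ge0 ?powR_ge0// ltW.
    - by apply: ht; rewrite d0.
  apply: (relativistic_op_le_of_tail n alpha m halpha hm mu w x cw wL aw Ux
    winf wx0 C _ 0) => //.
  - rewrite mulr0 pmulr_rle0// subr_le0.
    have -> : m = delta1 `^ (- alpha).
      by rewrite /delta1 -powRrM mulrNN mulVf ?gt_eqF// powRr1// ltW.
    rewrite !powRN lef_pV2 ?posrE ?powR_gt0//.
    by apply: ge0_ler_powR; rewrite ?nnegrE ?ltW.
  - by apply: integral_ge0 => h _; rewrite lee_fin radial_kernel_ge0.
move=> delta1 d10; have [t t0 ht] := tail _ d10.
(* delta^((d-alpha)/2) = delta^nu delta^(-alpha), and delta^nu <= D. *)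
pose D := delta1 `^ nu.
have D0 : 0 < D by rewrite powR_gt0.
pose C := Num.min q (2 * c * t / D).
have C0 : 0 < C by rewrite lt_min q0/= divr_gt0// mulr_gt0// mulr_gt0.
have Cq : C <= q by rewrite ge_min lexx.
have Ct : C * D <= 2 * c * t by rewrite -ler_pdivlMr// ge_min lexx orbT.
exists C; split => // mu w x [cw _] wL aw Ux winf wx0 delta dd1.
have /andP[d0 d1] := dd1.
apply: (relativistic_op_le_of_tail n alpha m halpha hm mu w x cw wL aw Ux
  winf wx0 C _ (t * delta `^ (- alpha))) => //.
- by rewrite -ler_pdivlMr.
- have -> : (n.+1%:R - alpha) / 2 = nu + - alpha by rewrite /nu; field.
  rewrite powRD ?(gt_eqF d0) ?implybT// mulrA mulrA.
  rewrite ler_wpM2r ?powR_ge0//; apply: le_trans Ct.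
  rewrite ler_wpM2l ?(ltW C0)//.
  by apply: ge0_ler_powR; rewrite ?nnegrE ?(ltW d0) ?(ltW d10).
- by rewrite mulr_ge0 ?powR_ge0// ltW.
- exact: ht.
Qed.
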